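(* Assume in addition that $q<0$ is a real number (so $t$ is real). The algebra $\mathcal{A}(\sigma)$ has an orthogonal decomposition $$\mathcal{A}(\sigma)=\bigoplus_{\ell\in\frac12\mathbb{Z}_+}\left(M_\ell\oplus M_\ell\sigma\right)$$ with respect to $\langle\,,\rangle_R$ or $\langle\,,\rangle_L$. Furthermore, the following relations hold (for $\ell,\ell'\in\frac12\mathbb{Z}_+$, $i,j\in I_\ell$, $i',j'\in I_{\ell'}$, $s,s'\in\{0,1\}$): $$\langle m^{(\ell)}_{ij}\sigma^s,\,m^{(\ell')}_{i'j'}\sigma^{s'}\rangle_R=[2\ell+1]_t^{-1}\,t^{2j}\,\delta_{\ell\ell'}\delta_{ii'}\delta_{jj'},$$ $$\langle m^{(\ell)}_{ij}\sigma^s,\,m^{(\ell')}_{i'j'}\sigma^{s'}\rangle_L=[2\ell+1]_t^{-1}\,t^{-2i}\,\delta_{\ell\ell'}\delta_{ii'}\delta_{jj'},$$ where $[2\ell+1]_t=\dfrac{t^{2\ell+1}-t^{-2\ell-1}}{t-t^{-1}}$.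
   Context: Here $q\neq 0$ is not a root of $1$ and $t=\sqrt{-1}\,\sqrt q$ (so $t^2=-q$). $\mathbb{Z}_+=\{0,1,2,\dots\}$. Tensor products of $\mathbb{Z}_2$-graded algebras have multiplication $(u\otimes v)(u'\otimes v')=(-1)^{p(v)p(u')}uu'\otimes vv'$, where $p$ is parity. $\mathcal{A}(\sigma)$ is the $\mathbb{Z}_2$-graded associative unital $\mathbb{C}$-algebra with generators $a,b,c,d,\sigma$, parities $p(a)=p(d)=p(\sigma)=0$, $p(b)=p(c)=1$, and relations $ab=tba$, $ac=tca$, $bc=-cb$, $bd=-tdb$, $cd=-tdc$, $ad-da=(t^{-1}-t)bc$, $\sigma a=a\sigma$, $\sigma d=d\sigma$, $\sigma b=-b\sigma$, $\sigma c=-c\sigma$, $\sigma^2=1$, $ad+tbc=\sigma$. It is a $\mathbb{Z}_2$-graded bialgebra with $\Delta(a)=a\otimes a+b\otimes c$, $\Delta(b)=a\otimes b+b\otimes d$, $\Delta(c)=c\otimes a+d\otimes c$, $\Delta(d)=c\otimes b+d\otimes d$, $\Delta(\sigma)=\sigma\otimes\sigma$, $\varepsilon(a)=\varepsilon(d)=\varepsilon(\sigma)=1$, $\varepsilon(b)=\varepsilon(c)=0$. For real $q<0$, the $\ast$-structure on $\mathcal{A}(\sigma)$ is the anti-linear map with $(xy)^\ast=y^\ast x^\ast$ and $a^\ast=d\sigma$, $b^\ast=tc\sigma$, $c^\ast=-t^{-1}b\sigma$, $d^\ast=a\sigma$, $\sigma^\ast=\sigma$. Put $(u;v)_m=\prod_{k=0}^{m-1}(1-uv^k)$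 and $\binom{m}{n}_v=\frac{(v;v)_m}{(v;v)_n(v;v)_{m-n}}$; $[x]$ is the integer part of $x$ (when not carrying the subscript $t$). For $\ell\in\frac12\mathbb{Z}_+$ let $I_\ell=\{-\ell,-\ell+1,\dots,\ell\}$ and, for $i\in I_\ell$, $\xi^{(\ell)}_i=(\sqrt{-1})^{[\frac{\ell+i}{2}]}\binom{2\ell}{\ell+i}^{1/2}_{t^{-2}}a^{\ell-i}c^{\ell+i}$. The elements $m^{(\ell)}_{ij}\in\mathcal{A}(\sigma)$ are defined by $\Delta(\xi^{(\ell)}_i)=\sum_{j\in I_\ell}m^{(\ell)}_{ij}\otimes\xi^{(\ell)}_j$, and $M_\ell\sigma^s=\sum_{i,j\in I_\ell}\mathbb{C}\,m^{(\ell)}_{ij}\sigma^s$ ($s=0,1$), with $M_\ell=M_\ell\sigma^0$. The elements $m^{(\ell)}_{ij}\sigma^s$ ($\ell\in\frac12\mathbb{Z}_+$, $i,j\in I_\ell$, $s=0,1$) form a $\mathbb{C}$-basis of $\mathcal{A}(\sigma)$. The Haar functional $h:\mathcal{A}(\sigma)\to\mathbb{C}$ is the linear functional defined on this basis by $h(m^{(0)}_{00}\sigma^s)=h(\sigma^s)=1$ for $s=0,1$, and $h(m^{(\ell)}_{ij}\sigma^s)=0$ for all $\ell\in\frac12\mathbb{Z}_+$ with $\ell>0$, $i,j\in I_\ell$, $s=0,1$. The two hermitian forms are $$\langle x,y\rangle_R=h(xy^\ast),\qquad\langle x,y\rangle_L=h(x^\ast y),\qquad x,y\in\mathcal{A}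(\sigma).$$
   Formalization: The R-relation is proved with an extra factor (-1)^{(s+s')(i-j)}: as printed it fails when s≠s' and i-j is odd, e.g. for b=m^{(1/2)}_{-1/2,1/2}, (bσ)*=-tc gives ⟨b,bσ⟩_R=-t/(t+t^{-1}), not +t/(t+t^{-1}). *)

(* Defs.v *)
From HB Require Import structures.
From mathcomp Require Import all_boot all_order all_algebra.
From mathcomp Require Import reals.
From mathcomp.real_closed Require Export complex.

Set Implicit Arguments.
Unset Strict Implicit.
Unset Printing Implicit Defensive.

Import Order.TTheory GRing.Theory Num.Theory.
Local Open Scope ring_scope.

(* Half-integers.  A spin l in (1/2)Z_+ is encoded by the natural number      *)
(* n = 2 l, and an index i in I_l = {-l, -l+1, ..., l} by the ordinal         *)
(* k = l + i in 'I_n.+1.  Hence l - i = n - k, 2 i = 2 k - n, 2 l + 1 = n + 1,*)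
(* and i - j has the parity of the sum of the encodings of i and j.           *)

Section Asigma.
Variables (C : numClosedFieldType) (t : C).

Record Asigma_relations (B : algType C) (a b c d s : B) : Prop := {
  rel_ab : a * b = t *: (b * a);
  rel_ac : a * c = t *: (c * a);
  rel_bc : b * c = - (c * b);
  rel_bd : b * d = - t *: (d * b);
  rel_cd : c * d = - t *: (d * c);
  rel_ad : a * d - d * a = (t^-1 - t) *: (b * c);
  rel_sa : s * a = a * s;
  rel_sd : s * d = d * s;
  rel_sb : s * b = - (b * s);
  rel_sc : s * c = - (c * s);
  rel_ss : s ^+ 2 = 1;
  rel_det : a * d + t *: (b * c) = s
}.

(* A is the algebra presented by the generators a, b, c, d, s and the         *)
(* relations above.                                                           *)
Record is_Asigma (A : algType C) (a b c d s : A) : Prop := {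
  Asigma_rel : Asigma_relations a b c d s;
  Asigma_gen : forall P : A -> Prop,
    P a -> P b -> P c -> P d -> P s -> P 1 ->
    (forall k x y, P x -> P y -> P (k *: x + y)) ->
    (forall x y, P x -> P y -> P (x * y)) ->
    forall x, P x;
  Asigma_univ : forall (B : algType C) (a' b' c' d' s' : B),
    Asigma_relations a' b' c' d' s' ->
    exists f : {lrmorphism A -> B},
      [/\ f a = a', f b = b', f c = c', f d = d' & f s = s']
}.

(* [Asigma_parity a b c d s p x]: x is homogeneous of parity p                *)
(* (false = even, true = odd).                                                *)
Inductive Asigma_parity (A : algType C) (a b c d s : A) : bool -> A -> Prop :=
| parity_a : Asigma_parity a b c d s false a
| parity_b : Asigma_parity a b c d s true b
| parity_c : Asigma_parity a b c d s true c
| parity_d : Asigma_parity a b c d s false d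
| parity_s : Asigma_parity a b c d s false s
| parity_1 : Asigma_parity a b c d s false 1
| parity_lin p k x y : Asigma_parity a b c d s p x ->
    Asigma_parity a b c d s p y -> Asigma_parity a b c d s p (k *: x + y)
| parity_0 p : Asigma_parity a b c d s p 0
| parity_mul p p' x y : Asigma_parity a b c d s p x ->
    Asigma_parity a b c d s p' y ->
    Asigma_parity a b c d s (p (+) p') (x * y).

End Asigma.

Definition bilinear_map (C : numClosedFieldType) (A W : lmodType C) (f : A -> A -> W) :=
  (forall y k x x', f (k *: x + x') y = k *: f x y + f x' y) /\
  (forall x k y y', f x (k *: y + y') = k *: f x y + f x y').

(* T, with the pure tensors [tens x y], is the tensor product of the          *)
(* Z_2-graded algebra A with itself: the first three fields say that T is the *)
(* tensor product of vector spaces, the last two give its multiplication.     *)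
Record is_graded_tensor (C : numClosedFieldType) (A T : algType C)
    (parity : bool -> A -> Prop) (tens : A -> A -> T) : Prop := {
  tens_bilinear : bilinear_map tens;
  tens_span : forall P : T -> Prop,
    (forall x y, P (tens x y)) ->
    (forall k u v, P u -> P v -> P (k *: u + v)) ->
    forall u, P u;
  tens_univ : forall (W : lmodType C) (f : A -> A -> W), bilinear_map f ->
    exists g : {linear T -> W}, forall x y, g (tens x y) = f x y;
  tens_one : tens 1 1 = 1;
  tens_mul : forall (p p' : bool) u v u' v', parity p v -> parity p' u' ->
    tens u v * tens u' v' = (-1) ^+ (p && p') *: tens (u * u') (v * v')
}.

Record is_coproduct (C : numClosedFieldType) (A T : algType C) (tens : A -> A -> T)
    (a b c d s : A) (Delta : {lrmorphism A -> T}) : Prop := {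
  Delta_a : Delta a = tens a a + tens b c;
  Delta_b : Delta b = tens a b + tens b d;
  Delta_c : Delta c = tens c a + tens d c;
  Delta_d : Delta d = tens c b + tens d d;
  Delta_s : Delta s = tens s s
}.

Section HaarForms.
Variables (C : numClosedFieldType) (t : C) (A : algType C).
Variables a b c d s : A.

Record is_star (star : A -> A) : Prop := {
  star_antilinear : forall k x y, star (k *: x + y) = k^* *: star x + star y;
  star_mul : forall x y, star (x * y) = star y * star x;
  star_a : star a = d * s;
  star_b : star b = t *: (c * s);
  star_c : star c = - t^-1 *: (b * s);
  star_d : star d = a * s;
  star_s : star s = s
}.

Definition qpoch (u v : C) (m : nat) : C := \prod_(k < m) (1 - u * v ^+ k).

Definition qbinom (v : C) (m n : nat) : C :=
  qpoch v v m / (qpoch v v n * qpoch v v (m - n)).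

Definition qint (n : nat) : C := (t ^+ n - t ^- n) / (t - t^-1).

Definition xi (n : nat) (k : 'I_n.+1) : A :=
  ('i ^+ k./2 * sqrtC (qbinom (t ^- 2) n k)) *: (a ^+ (n - k) * c ^+ k).

Definition is_matrix_elements (T : algType C) (tens : A -> A -> T)
    (Delta : A -> T) (m : forall n, 'I_n.+1 -> 'I_n.+1 -> A) : Prop :=
  forall n (i : 'I_n.+1), Delta (xi i) = \sum_(j < n.+1) tens (m n i j) (xi j).

Variable m : forall n, 'I_n.+1 -> 'I_n.+1 -> A.

Definition is_haar (h : {scalar A}) : Prop :=
  (forall e : bool, h (@m 0%N ord0 ord0 * s ^+ e) = 1) /\
  (forall n (i j : 'I_n.+1) (e : bool), (0 < n)%N -> h (m i j * s ^+ e) = 0).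

(* M_l s^e *)
Definition Mspace (n : nat) (e : bool) (x : A) : Prop :=
  exists u : 'I_n.+1 -> 'I_n.+1 -> C,
    x = \sum_(i < n.+1) \sum_(j < n.+1) u i j *: (m i j * s ^+ e).

(* M_l + M_l s *)
Definition Msum (n : nat) (x : A) : Prop :=
  exists x0 x1, [/\ Mspace n false x0, Mspace n true x1 & x = x0 + x1].

(* For odd x, star (x * s) = s * star x = - (star x * s): moving s across an  *)
(* odd factor changes the sign.  Hence formR x (x * s) = - formR x x for odd  *)
(* x, whereas formL x (x * s) = formL x x since star x * x is even (h takes   *)
(* the same value on y * s as on y, by its definition on the basis).          *)
Definition formR (star : A -> A) (h : A -> C) (x y : A) : C := h (x * star y).
Definition formL (star : A -> A) (h : A -> C) (x y : A) : C := h (star x * y).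

End HaarForms.

Definition direct_sum (C : numClosedFieldType) (A : lmodType C) (I : eqType)
    (V : I -> A -> Prop) : Prop :=
  (forall x : A, exists (r : seq I) (y : I -> A),
     (forall i, V i (y i)) /\ x = \sum_(i <- r) y i) /\
  (forall (r : seq I) (y : I -> A), uniq r -> (forall i, V i (y i)) ->
     \sum_(i <- r) y i = 0 -> forall i, i \in r -> y i = 0).

Definition orthogonal_family (C : numClosedFieldType) (A : lmodType C) (I : eqType)
    (form : A -> A -> C) (V : I -> A -> Prop) : Prop :=
  forall i j x y, i != j -> V i x -> V j y -> form x y = 0.

(* Main.v *)
Require Import Defs.
From HB Require Import structures.
From mathcomp Require Import all_boot all_order all_algebra.
From mathcomp Require Import reals.
From mathcomp Require Import ring zify.

Set Implicit Arguments.
Unset Strict Implicit.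
Unset Printing Implicit Defensive.

Import Order.TTheory GRing.Theory Num.Theory.
Local Open Scope ring_scope.

(* The elements a, -b, c s, d s satisfy the relations of the ordinary quantum *)
(* group SL_t(2), and on it the star operation is that of SU_t(2).  Up to     *)
(* scalars and powers of s, the matrix elements are elements K^n_ij given by  *)
(* a recursion in n that is symmetric under transposition.  The relations     *)
(* between K^n and K^(n+1) determine K^n_ij g, for a generator g, as an       *)
(* explicit combination of one element of K^(n+1) and one of K^(n-1)          *)
(* (Clebsch-Gordan).  This shows that the K^n_ij s^e span, and it computes    *)
(* h(K^n_ij (K^n'_i'j')^* s^e) by induction on n': expand K^n' by the         *)
(* recursion, move the generator to the left factor and apply Clebsch-Gordan. *)
(* The form <,>_L is reduced to <,>_R since star exchanges K^n_ij and         *)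
(* K^n_(n-i)(n-j) up to a scalar.  Independence comes from the same           *)
(* computation with h + h o f, where f is the automorphism that fixes a, b    *)
(* and changes the sign of c, d, s: it fixes K^n_ij and separates e = 0 from  *)
(* e = 1.                                                                     *)

(** The statement is the Peter-Weyl theorem with Schur orthogonality for the compact quantum group
    SU_t(2), doubled by the powers of [s]. The space M_l consists of the coefficients of the
    corepresentation of dimension n + 1, where n = 2l. The relation of these coefficients to the
    generators is tensoring with spin 1/2, which splits into n + 1 and n - 1.

    [Asigma_qSL2] removes the grading: [a], [- b], [c * s], [d * s] generate an ordinary SL_t(2).
    There [qmx] is a matrix coefficient multiplied by a Gaussian binomial, which makes it symmetric
    under transposition. [coproduct_row] exhibits an expansion of Delta(a^(n-i) c^i), and
    [row_unique] shows that such an expansion is unique; together they give [matrix_element_qmx].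

    The Clebsch-Gordan lemmas [qmx_mul_a], [qmx_mul_b], [qmx_mul_c], [qmx_mul_d] make the span of
    the [qmx] times powers of [s] stable under right multiplication, so it is everything
    ([qmx_spanT]). They also drive [qmx_orthogonal], where the norm is t^(2(j-n)) G_i G_j / [n+1]
    with Gaussians G in base t^(-2). The scalars relating [m] to [qmx] have squared modulus 1/(G_i
    G_j) ([entry_scale_norm]), which leaves t^(2j-n) over the symmetric quantum integer.

    The sign in the right form arises from moving [s] across one element of parity i + j; in the
    left form [s] crosses two factors of equal parity. The functional [h] does not distinguish
    powers of [s], so independence ([Mspace_independent]) uses [twisted_haar], which vanishes on odd
    powers. *)

Section LinearExpressions.
Variables (F : fieldType) (V : lmodType F).

Inductive lexp := LVar of nat | LZero | LAdd of lexp & lexp | LOpp of lexp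
  | LScale of F & lexp.

Fixpoint leval (vs : seq V) (e : lexp) : V :=
  match e with
  | LVar k => vs`_k
  | LZero => 0
  | LAdd e1 e2 => leval vs e1 + leval vs e2
  | LOpp e1 => - leval vs e1
  | LScale k e1 => k *: leval vs e1
  end.

Fixpoint lcoef (k : nat) (e : lexp) : F :=
  match e with
  | LVar k' => if k' == k then 1 else 0
  | LZero => 0
  | LAdd e1 e2 => lcoef k e1 + lcoef k e2
  | LOpp e1 => - lcoef k e1
  | LScale x e1 => x * lcoef k e1
  end.

Lemma leval_sum vs e :
  leval vs e = \sum_(k < size vs) lcoef k e *: vs`_k.
Proof.
elim: e => [k||e1 IH1 e2 IH2|e1 IH1|x e1 IH1] /=.
- have [lt_k|ge_k] := ltnP k (size vs); last first.
    rewrite nth_default // big1 // => j _.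
    by rewrite (gtn_eqF (leq_trans (ltn_ord j) ge_k)) scale0r.
  rewrite (bigD1 (Ordinal lt_k)) //= eqxx scale1r big1 ?addr0 // => j.
  by rewrite -val_eqE /= eq_sym => /negPf->; rewrite scale0r.
- by rewrite big1 // => j _; rewrite scale0r.
- by rewrite IH1 IH2 -big_split /=; apply: eq_bigr => j _; rewrite scalerDl.
- by rewrite IH1 -sumrN; apply: eq_bigr => j _; rewrite scaleNr.
- by rewrite IH1 scaler_sumr; apply: eq_bigr => j _; rewrite scalerA.
Qed.

Fixpoint lcoef_eq (n : nat) (e1 e2 : lexp) : Prop :=
  if n is n'.+1 then lcoef n' e1 = lcoef n' e2 /\ lcoef_eq n' e1 e2 else True.

(** Equal coefficients suffice for any list of vectors, so an identity between words in the
    generators reduces to scalar identities. *)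
Lemma leval_eq vs e1 e2 : lcoef_eq (size vs) e1 e2 -> leval vs e1 = leval vs e2.
Proof.
rewrite !leval_sum; elim: (size vs) => [|n IHn] /=; first by rewrite !big_ord0.
by case=> eq_n /IHn eq_lt; rewrite !big_ord_recr /= eq_lt eq_n.
Qed.

End LinearExpressions.

Ltac lexp_index x vs :=
  lazymatch vs with
  | ?y :: ?vs' =>
    match goal with
    | _ => let _ := constr:(erefl x : x = y) in constr:(0%N)
    | _ => let k := lexp_index x vs' in constr:(k.+1)
    end
  end.

Ltac lexp_reify F vs x :=
  lazymatch x with
  | ?y + ?z => let e := lexp_reify F vs y in let e' := lexp_reify F vs z in
               constr:(LAdd e e')
  | - ?y => let e := lexp_reify F vs y in constr:(LOpp e)
  | ?k *: ?y => let e := lexp_reify F vs y in constr:(LScale k e)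
  | 0 => constr:(@LZero F)
  | _ => let k := lexp_index x vs in constr:(@LVar F k)
  end.

(* The goals are the equalities of the coefficients of [vs], last vector      *)
(* first.                                                                     *)
Ltac linear_combination F vs :=
  lazymatch goal with
  | |- ?x = ?y =>
    let e := lexp_reify F vs x in
    let e' := lexp_reify F vs y in
    apply: (@leval_eq F _ vs e e'); rewrite /=; do ! split
  end.

(** * The quantum group SL_t(2) *)

Section QNumbers.
Variables (F : fieldType) (t : F).

(** The quantum integer in base [t ^- 2]; [gauss] is the Gaussian binomial in the same base, given
    by Pascal's rule. *)
Definition qnum (i : int) : F := (1 - (t ^ i) ^- 2) / (1 - t ^- 2).

Fixpoint gauss (n : nat) (i : int) : F :=
  if n is n'.+1 then (t ^ i) ^- 2 * gauss n' i + gauss n' (i - 1)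
  else (i == 0)%:R.

End QNumbers.

Section QuantumMatrices.
Variables (F : fieldType) (t : F) (A : algType F).

Record qSL2 (a b c d : A) : Prop := {
  qSL2_ab : a * b = t *: (b * a);
  qSL2_ac : a * c = t *: (c * a);
  qSL2_bc : b * c = c * b;
  qSL2_bd : b * d = t *: (d * b);
  qSL2_cd : c * d = t *: (d * c);
  qSL2_ad : a * d = 1 + t *: (b * c);
  qSL2_da : d * a = 1 + t^-1 *: (b * c)
}.

Variables a b c d : A.

(* Integer indices, with value 0 out of range, avoid all boundary cases.      *)
Fixpoint qmx (n : nat) (i j : int) : A :=
  if n is n'.+1 then
    (t ^ i * t ^ j)^-1 *: (qmx n' i j * a) + (t ^ i)^-1 *: (qmx n' i (j - 1) * b)
    + (t ^ j)^-1 *: (qmx n' (i - 1) j * c) + qmx n' (i - 1) (j - 1) * d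
  else if (i == 0) && (j == 0) then 1 else 0.

End QuantumMatrices.

(** With [qmx_tr], this transposition symmetry turns each recurrence along rows into one along
    columns. *)
Lemma qSL2_tr (F : fieldType) (t : F) (A : algType F) (a b c d : A) :
  qSL2 t a b c d -> qSL2 t a c b d.
Proof. by case=> ab ac bc bd cd ad da; split; rewrite // -bc. Qed.

Lemma qmx_tr (F : fieldType) (t : F) (A : algType F) (a b c d : A) n i j :
  qmx t a c b d n i j = qmx t a b c d n j i.
Proof.
elim: n i j => [|n IHn] i j /=; first by rewrite andbC.
by rewrite !IHn [t ^ i * _]mulrC -!addrA; congr (_ + _); rewrite addrCA.
Qed.

Section QNumberTheory.
Variables (F : fieldType) (t : F).
Hypothesis t0 : t != 0.
Hypothesis t_root : forall n, t ^+ 2 ^+ n.+1 != 1.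

Lemma exprzD_neq0 i j : t ^ (i + j) = t ^ i * t ^ j.
Proof. exact: expfzDr. Qed.

Lemma exprzN (i : int) : t ^ (- i) = (t ^ i)^-1.
Proof. by rewrite invr_expz. Qed.

Definition exprzE := (exprzD_neq0, exprzN, expr1z, intS, expr0z).

Lemma sqr_sub1_neq0 : t ^+ 2 - 1 != 0.
Proof. by rewrite subr_eq0; have := t_root 0; rewrite expr1. Qed.

Lemma qnum0 : qnum t 0 = 0.
Proof. by rewrite /qnum expr0z expr1n invr1 subrr mul0r. Qed.

Lemma qnum1 : qnum t 1 = 1.
Proof.
rewrite /qnum expr1z; apply: divff.
by rewrite subr_eq0 eq_sym invr_eq1 -subr_eq0 sqr_sub1_neq0.
Qed.

Lemma qnum_neq0 (n : nat) : qnum t n.+1 != 0.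
Proof.
rewrite /qnum mulf_neq0 ?invr_neq0 // subr_eq0 eq_sym invr_eq1.
  by have := t_root n; rewrite -!exprM mulnC.
by rewrite -subr_eq0 sqr_sub1_neq0.
Qed.

End QNumberTheory.

(** Powers with symbolic exponents become nonzero atoms, which leaves an identity of rational
    functions. *)
Ltac qfield t0 t_root :=
  rewrite /qnum ?(exprzE t0);
  repeat match goal with
  | |- context [?x ^ ?i] =>
     let u := fresh "u" in let u0 := fresh "u0" in
     have u0 := expfz_neq0 i t0; move: (x ^ i) u0 => u u0
  end;
  field; repeat (apply/andP; split);
  first [assumption | exact: (sqr_sub1_neq0 t_root)].

Section Recursions.
Variables (F : fieldType) (t : F) (A : algType F) (a b c d : A).
Hypothesis t0 : t != 0.
Hypothesis t_root : forall n, t ^+ 2 ^+ n.+1 != 1.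
Hypothesis rel : qSL2 t a b c d.

Local Notation qn := (qnum t).
Local Notation K := (qmx t a b c d).

(** The recursion reads K^(n+1) = t^(-i) U + V. If U and V are proportional as assumed, then [n+1] =
    t^(-2i) [n+1-i] + [i] recovers each of them from K^(n+1). *)
Lemma qmx_balance_step n i j :
  qn (n.+1%:Z - i) *: ((t ^ j)^-1 *: (K n (i - 1) j * c) + K n (i - 1) (j - 1) * d)
    = (t ^ i * qn i) *: ((t ^ j)^-1 *: (K n i j * a) + K n i (j - 1) * b) ->
  qn (n.+1%:Z - i) *: K n.+1 i j
    = (t ^ i * qn n.+1%:Z) *: ((t ^ j)^-1 *: (K n i j * a) + K n i (j - 1) * b) /\
  qn i *: K n.+1 i j
    = qn n.+1%:Z *: ((t ^ j)^-1 *: (K n (i - 1) j * c) + K n (i - 1) (j - 1) * d).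
Proof.
move=> eqUV /=.
set U := _ + K n i (j - 1) * b in eqUV *.
set V := _ + K n (i - 1) (j - 1) * d in eqUV *.
have -> : (t ^ i * t ^ j)^-1 *: (K n i j * a) + (t ^ i)^-1 *: (K n i (j - 1) * b)
    + (t ^ j)^-1 *: (K n (i - 1) j * c) + K n (i - 1) (j - 1) * d
    = (t ^ i)^-1 *: U + V.
  by rewrite -!addrA addrA scalerDr scalerA invfM.
split; rewrite scalerDr ?eqUV.
  rewrite !scalerA -scalerDl; congr (_ *: _).
  by qfield t0 t_root.
have -> : qn i *: ((t ^ i)^-1 *: U) = (t ^ i) ^- 2 *: (t ^ i * qn i *: U).
  rewrite !scalerA; congr (_ *: _).
  by qfield t0 t_root.
rewrite -eqUV scalerA -scalerDl; congr (_ *: _).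
by qfield t0 t_root.
Qed.

Lemma qmx_balance n i j :
  qn (n.+1%:Z - i) *: ((t ^ j)^-1 *: (K n (i - 1) j * c) + K n (i - 1) (j - 1) * d)
    = (t ^ i * qn i) *: ((t ^ j)^-1 *: (K n i j * a) + K n i (j - 1) * b).
Proof.
elim: n i j => [|n IHn] i j.
  rewrite /= !subr_eq0; have [->|i_neq0] := eqVneq i 0.
    by rewrite qnum0 /= mulr0 scale0r !mul0r; linear_combination F (@nil A).
  have [->|i_neq1] := eqVneq i 1; rewrite /= !mul0r.
    by rewrite subrr qnum0; linear_combination F [::
      (if j == 0 then 1 else 0) * c; (if j == 1 then 1 else 0) * d]; ring.
  by linear_combination F (@nil A).
pose U i' j' := (t ^ j')^-1 *: (K n i' j' * a) + K n i' (j' - 1) * b.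
pose V i' j' := (t ^ j')^-1 *: (K n i' j' * c) + K n i' (j' - 1) * d.
(* The case n rewrites all factors in terms of row i - 1 of K^n. What remains is words of length two
   in the generators, which the relations of SL_t(2) match. *)
have row1 j' : qn (n.+2%:Z - i) *: K n.+1 (i - 1) j'
    = (t ^ (i - 1) * qn n.+1%:Z) *: U (i - 1) j'.
  have -> : n.+2%:Z - i = n.+1%:Z - (i - 1) by lia.
  by have [] := qmx_balance_step (IHn (i - 1) j').
have row2 j' : qn i *: K n.+1 i j' = qn n.+1%:Z *: V (i - 1) j'.
  by have [] := qmx_balance_step (IHn i j').
transitivity ((t ^ j)^-1 *: (qn (n.+2%:Z - i) *: K n.+1 (i - 1) j * c)
    + qn (n.+2%:Z - i) *: K n.+1 (i - 1) (j - 1) * d).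
  rewrite -!scalerAl.
  by linear_combination F [:: K n.+1 (i - 1) j * c; K n.+1 (i - 1) (j - 1) * d]; ring.
transitivity (t ^ i *: ((t ^ j)^-1 *: (qn i *: K n.+1 i j * a)
    + qn i *: K n.+1 i (j - 1) * b)); last first.
  rewrite -!scalerAl.
  by linear_combination F [:: K n.+1 i j * a; K n.+1 i (j - 1) * b]; ring.
rewrite !row1 !row2 /U /V.
rewrite !(=^~ scalerAl, mulrDl) -!mulrA.
rewrite (qSL2_ac rel) (qSL2_ad rel) (qSL2_bd rel) (qSL2_da rel) -(qSL2_bc rel).
rewrite !mulrDr -!scalerAr !mulr1.
linear_combination F [:: K n (i - 1) j * (c * a); K n (i - 1) (j - 1) * (b * c);
  K n (i - 1) (j - 1); K n (i - 1) (j - 1 - 1) * (d * b)].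
all: qfield t0 t_root.
Qed.

Lemma qmx_rows n i j :
  qn (n.+1%:Z - i) *: K n.+1 i j
    = (t ^ i * qn n.+1%:Z) *: ((t ^ j)^-1 *: (K n i j * a) + K n i (j - 1) * b) /\
  qn i *: K n.+1 i j
    = qn n.+1%:Z *: ((t ^ j)^-1 *: (K n (i - 1) j * c) + K n (i - 1) (j - 1) * d).
Proof. exact/qmx_balance_step/qmx_balance. Qed.

(** The combination is chosen so that the words [b * c] and [d * b] cancel; the constant 1 of the
    quantum determinant relation survives and lowers the degree. *)
Lemma qmx_lower n i j :
  qn (n.+1%:Z - i) *: (K n (i - 1) (j - 1) * d) - (t ^ i * qn i) *: (K n i (j - 1) * b)
    = (t ^ i / t ^ j * qn n) *: K n.-1 (i - 1) (j - 1).
Proof.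
case: n => [|n].
  (* For n = 0 the predecessor is again 0, and the factor [0] = 0 removes that term. *)
  rewrite qnum0 mulr0 /= !subr_eq0; have [->|i_neq0] := eqVneq i 0.
    by rewrite qnum0 /= mulr0 !mul0r;
      linear_combination F [:: (if j == 1 then 1 else 0) * b]; ring.
  have [->|i_neq1] := eqVneq i 1; rewrite /= !mul0r.
    rewrite subrr qnum0.
    by linear_combination F [:: (if j == 1 then 1 else 0) * d;
      (if j == 1 then 1 else 0 : A)]; ring.
  by linear_combination F (@nil A).
have row1 : qn (n.+2%:Z - i) *: K n.+1 (i - 1) (j - 1)
    = (t ^ (i - 1) * qn n.+1%:Z) *: ((t ^ (j - 1))^-1 *: (K n (i - 1) (j - 1) * a)
        + K n (i - 1) (j - 1 - 1) * b).
  have -> : n.+2%:Z - i = n.+1%:Z - (i - 1) by lia.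
  by have [] := qmx_rows n (i - 1) (j - 1).
have [_ row2] := qmx_rows n i (j - 1).
rewrite -scalerA !scalerAl row1 row2 /=.
rewrite !(=^~ scalerAl, mulrDl) -!mulrA.
rewrite (qSL2_ad rel) (qSL2_bd rel) -(qSL2_bc rel).
rewrite !mulrDr -!scalerAr !mulr1.
linear_combination F [:: K n (i - 1) (j - 1) * (b * c);
  K n (i - 1) (j - 1); K n (i - 1) (j - 1 - 1) * (d * b)].
all: qfield t0 t_root.
Qed.

End Recursions.

(** * Products of matrix coefficients with generators (Clebsch-Gordan) *)

Section ClebschGordan.
Variables (F : fieldType) (t : F) (A : algType F) (a b c d : A).
Hypothesis t0 : t != 0.
Hypothesis t_root : forall n, t ^+ 2 ^+ n.+1 != 1.
Hypothesis rel : qSL2 t a b c d.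

Local Notation qn := (qnum t).
Local Notation K := (qmx t a b c d).

Let N0 (n : nat) : qn n.+1 != 0. Proof. exact: qnum_neq0. Qed.
Let u0 i : t ^ i != 0. Proof. exact: expfz_neq0. Qed.

Lemma qnum_compl (n i : int) : qn (n - i) = (t ^ i) ^+ 2 * (qn n - qn i).
Proof. by qfield t0 t_root. Qed.

(** The column recurrence and [qmx_lower] are two linear equations in K_(i,j) d and K_(i+1,j) b.
    Their determinant is a power of t times [n+1], hence invertible. The other three products follow
    by substitution and transposition. *)
Lemma qmx_mul_d n i j :
  K n i j * d = (qn (i + 1) * qn (j + 1) / qn n.+1 ^+ 2) *: K n.+1 (i + 1) (j + 1)
    + (qn n / (qn n.+1 * t ^ (i + 1) * t ^ (j + 1))) *: K n.-1 i j.
Proof.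
have [_ ] := qmx_rows t0 t_root (qSL2_tr rel) n (j + 1) (i + 1).
have := qmx_lower t0 t_root rel n (i + 1) (j + 1).
rewrite !(qmx_tr t a b c d) !addrK qnum_compl => low col.
transitivity (((t ^ (i + 1)) ^+ 2 * qn n.+1)^-1 *:
    ((t ^ (i + 1) / t ^ (j + 1) * qn n) *: K n.-1 i j)
  + (qn (i + 1) / qn n.+1 ^+ 2) *: (qn (j + 1) *: K n.+1 (i + 1) (j + 1))).
  rewrite -low col.
  linear_combination F [:: K n i j * d; K n (i + 1) j * b].
    by field; rewrite N0 u0.
  by field; rewrite N0 u0.
linear_combination F [:: K n.+1 (i + 1) (j + 1); K n.-1 i j].
  by field; rewrite N0 !u0.
by field; rewrite N0 !u0.
Qed.

Lemma qmx_mul_b n i j :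
  K n i j * b = (qn (j + 1) * qn (n.+1%:Z - i) / (qn n.+1 ^+ 2 * t ^ i))
      *: K n.+1 i (j + 1)
    - (qn n / (qn n.+1 * t ^ (j + 1))) *: K n.-1 (i - 1) j.
Proof.
have [_ ] := qmx_rows t0 t_root (qSL2_tr rel) n (j + 1) i.
rewrite !(qmx_tr t a b c d) !addrK => col.
transitivity ((t ^ i / qn n.+1) *: (qn (j + 1) *: K n.+1 i (j + 1))
              - t ^ i *: (K n (i - 1) j * d)).
  rewrite col; linear_combination F [:: K n i j * b; K n (i - 1) j * d].
    by field; rewrite N0 u0.
  by field; rewrite N0 u0.
rewrite qmx_mul_d subrK qnum_compl.
linear_combination F [:: K n.+1 i (j + 1); K n.-1 (i - 1) j].
  by field; rewrite N0 !u0.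
by field; rewrite N0 !u0.
Qed.

Lemma qmx_mul_a n i j :
  K n i j * a = (qn (n.+1%:Z - i) * qn (n.+1%:Z - j) / (qn n.+1 ^+ 2 * t ^ i * t ^ j))
      *: K n.+1 i j
    + (qn n / qn n.+1) *: K n.-1 (i - 1) (j - 1).
Proof.
have [row _] := qmx_rows t0 t_root rel n i j.
transitivity ((t ^ j / (t ^ i * qn n.+1)) *: (qn (n.+1%:Z - i) *: K n.+1 i j)
              - t ^ j *: (K n i (j - 1) * b)).
  rewrite row; linear_combination F [:: K n i j * a; K n i (j - 1) * b].
    by field; rewrite N0 !u0.
  by field; rewrite N0 !u0.
rewrite qmx_mul_b subrK [qn (_ - j)]qnum_compl.
linear_combination F [:: K n.+1 i j; K n.-1 (i - 1) (j - 1)].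
  by field; rewrite N0 !u0.
by field; rewrite N0 !u0.
Qed.

End ClebschGordan.

Lemma qmx_mul_c (F : fieldType) (t : F) (A : algType F) (a b c d : A) n i j :
  t != 0 -> (forall n, t ^+ 2 ^+ n.+1 != 1) -> qSL2 t a b c d ->
  qmx t a b c d n i j * c
    = (qnum t (i + 1) * qnum t (n.+1%:Z - j) / (qnum t n.+1 ^+ 2 * t ^ j))
      *: qmx t a b c d n.+1 (i + 1) j
    - (qnum t n / (qnum t n.+1 * t ^ (i + 1))) *: qmx t a b c d n.-1 i (j - 1).
Proof.
move=> t0 t_root rel.
have := qmx_mul_b t0 t_root (qSL2_tr rel) n j i.
by rewrite !(qmx_tr t a b c d).
Qed.

Section LeftRecursion.
Variables (F : fieldType) (t : F) (A : algType F) (a b c d : A).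
Hypothesis t0 : t != 0.
Hypothesis t_root : forall n, t ^+ 2 ^+ n.+1 != 1.

Local Notation K := (qmx t a b c d).

Lemma qmxS n i j : K n.+1 i j =
  (t ^ i * t ^ j)^-1 *: (K n i j * a) + (t ^ i)^-1 *: (K n i (j - 1) * b)
  + (t ^ j)^-1 *: (K n (i - 1) j * c) + K n (i - 1) (j - 1) * d.
Proof. by []. Qed.

(** Left and right multiplications commute: expanding by the recursion on one side and by the
    induction hypothesis on the other gives the same sixteen words. *)
Lemma qmxS_left n i j : K n.+1 i j =
  a * K n i j + (t ^ j / t ^+ n.+1) *: (b * K n i (j - 1))
  + (t ^ i / t ^+ n.+1) *: (c * K n (i - 1) j)
  + (t ^ i * t ^ j / t ^+ n.+1 ^+ 2) *: (d * K n (i - 1) (j - 1)).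
Proof.
elim: n i j => [|n IHn] i j.
  rewrite /= expr1 !subr_eq0.
  have [->|i0] := eqVneq i 0; first have [->|j0] := eqVneq j 0.
  - rewrite /= !expr0z !(mul0r, mulr0, mul1r, mulr1).
    by linear_combination F [:: a]; field; rewrite ?oner_eq0 ?t0.
  - have [->|j1] := eqVneq j 1; rewrite /= !(mul0r, mulr0, mul1r, mulr1).
      by linear_combination F [:: b]; rewrite expr0z expr1z; field; rewrite ?oner_eq0 ?t0.
    by linear_combination F (@nil A).
  have [->|i1] := eqVneq i 1; last first.
    by rewrite /= !(mul0r, mulr0); linear_combination F (@nil A).
  have [->|j0] := eqVneq j 0.
    rewrite /= !(mul0r, mulr0, mul1r, mulr1).
    by linear_combination F [:: c]; rewrite expr0z expr1z; field; rewrite ?oner_eq0 ?t0.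
  have [->|j1] := eqVneq j 1; rewrite /= !(mul0r, mulr0, mul1r, mulr1).
    by linear_combination F [:: d]; rewrite expr1z; field; rewrite ?oner_eq0 ?t0.
  by linear_combination F (@nil A).
rewrite [LHS]qmxS ![in LHS]IHn !qmxS.
rewrite !(=^~ scalerAl, =^~ scalerAr, mulrDl, mulrDr) -!mulrA.
linear_combination F [::
  a * (K n i j * a); b * (K n i (j - 1) * a);
  c * (K n (i - 1) j * a); d * (K n (i - 1) (j - 1) * a);
  a * (K n i (j - 1) * b); b * (K n i (j - 1 - 1) * b);
  c * (K n (i - 1) (j - 1) * b); d * (K n (i - 1) (j - 1 - 1) * b);
  a * (K n (i - 1) j * c); b * (K n (i - 1) (j - 1) * c);
  c * (K n (i - 1 - 1) j * c); d * (K n (i - 1 - 1) (j - 1) * c);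
  a * (K n (i - 1) (j - 1) * d); b * (K n (i - 1) (j - 1 - 1) * d);
  c * (K n (i - 1 - 1) (j - 1) * d); d * (K n (i - 1 - 1) (j - 1 - 1) * d)].
all: rewrite !exprS; have := expf_neq0 n t0; move: (t ^+ n) => w w0.
all: qfield t0 t_root.
Qed.

End LeftRecursion.

Lemma gauss_out (F : fieldType) (t : F) n (i : int) :
  (i < 0) || (n%:Z < i) -> gauss t n i = 0.
Proof.
elim: n i => [|n IHn] i /= out; first by rewrite (_ : i == 0 = false) //; lia.
by rewrite !IHn ?mulr0 ?addr0 //; lia.
Qed.

Lemma qmx_out (F : fieldType) (t : F) (A : algType F) (a b c d : A) n (i j : int) :
  [|| i < 0, n%:Z < i, j < 0 | n%:Z < j] -> qmx t a b c d n i j = 0.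
Proof.
elim: n i j => [|n IHn] i j out.
  by rewrite /= (_ : (i == 0) && (j == 0) = false) //; lia.
by rewrite qmxS !IHn ?mul0r ?scaler0 ?addr0 //; lia.
Qed.

Lemma qmx_cases (F : fieldType) (t : F) (A : algType F) (a b c d : A) (P : A -> Prop)
    n (i j : int) : P 0 ->
  (forall i' j' : 'I_n.+1, P (qmx t a b c d n i' j')) -> P (qmx t a b c d n i j).
Proof.
move=> P0 PK; have [out|in_range] := boolP [|| i < 0, n%:Z < i, j < 0 | n%:Z < j].
  by rewrite qmx_out.
have [i' le_i ->] : exists2 i' : nat, (i' < n.+1)%N & i = i' by exists `|i|%N; lia.
have [j' le_j ->] : exists2 j' : nat, (j' < n.+1)%N & j = j' by exists `|j|%N; lia.
exact: (PK (Ordinal le_i) (Ordinal le_j)).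
Qed.

(** * The star operation on matrix coefficients *)

Section Star.
Variables (C : numClosedFieldType) (A : algType C) (star : A -> A).
Hypothesis star_lin : forall k x y, star (k *: x + y) = k^* *: star x + star y.

Lemma star0 : star 0 = 0.
Proof.
have := star_lin 1 0 0; rewrite scaler0 addr0 rmorph1 scale1r => /esym.
by move=> /(canRL (addrK _)) ->; rewrite subrr.
Qed.

Lemma starD x y : star (x + y) = star x + star y.
Proof. by rewrite -[x in LHS]scale1r star_lin rmorph1 scale1r. Qed.

Lemma starZ k x : star (k *: x) = k^* *: star x.
Proof. by rewrite -[_ *: x]addr0 star_lin star0 addr0. Qed.

Variables (t : C) (a b c d : A).
Hypothesis t0 : t != 0.
Hypothesis t_root : forall n, t ^+ 2 ^+ n.+1 != 1.
Hypothesis t_real : t^* = t.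
Hypothesis starM : forall x y, star (x * y) = star y * star x.
Hypothesis star1 : star 1 = 1.
Hypothesis star_a : star a = d.
Hypothesis star_b : star b = - t *: c.
Hypothesis star_c : star c = - t^-1 *: b.
Hypothesis star_d : star d = a.

Local Notation K := (qmx t a b c d).

Lemma conj_exprz (i : int) : (t ^ i)^* = t ^ i.
Proof. by rewrite fmorphXz /= t_real. Qed.

Lemma qmxS_star n i j : star (K n.+1 i j) =
  (t ^ i * t ^ j)^-1 *: (d * star (K n i j))
  - (t / t ^ i) *: (c * star (K n i (j - 1)))
  - (t * t ^ j)^-1 *: (b * star (K n (i - 1) j)) + a * star (K n (i - 1) (j - 1)).
Proof.
rewrite qmxS !starD !starZ !starM star_a star_b star_c star_d.
rewrite !fmorphV rmorphM /= !conj_exprz -!scalerAl.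
linear_combination C [:: d * star (K n i j); c * star (K n i (j - 1));
  b * star (K n (i - 1) j); a * star (K n (i - 1) (j - 1))].
all: qfield t0 t_root.
Qed.

(** The star reverses products, so it carries the right recursion to [qmxS_left]; replacing i, j by
    n - i, n - j exchanges [a] with [d] and [b] with [c]. *)
Lemma qmx_star n i j :
  star (K n i j) = ((- t) ^ j / (- t) ^ i) *: K n (n%:Z - i) (n%:Z - j).
Proof.
have nt0 : - t != 0 by rewrite oppr_eq0.
elim: n i j => [|n IHn] i j.
  rewrite /= !sub0r !oppr_eq0.
  have [->|] := eqVneq i 0; last by rewrite /= star0 scaler0.
  by have [->|] := eqVneq j 0; rewrite /= ?star0 ?scaler0 // divr1 scale1r.
rewrite qmxS_star qmxS_left // !IHn.
have -> : n%:Z - i = n.+1%:Z - i - 1 by lia.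
have -> : n%:Z - j = n.+1%:Z - j - 1 by lia.
have -> : n%:Z - (i - 1) = n.+1%:Z - i by lia.
have -> : n%:Z - (j - 1) = n.+1%:Z - j by lia.
rewrite -!scalerAr; set i' := n.+1%:Z - i; set j' := n.+1%:Z - j.
linear_combination C [:: a * K n i' j'; b * K n i' (j' - 1);
  c * K n (i' - 1) j'; d * K n (i' - 1) (j' - 1)].
all: rewrite /i' /j' !(exprzE nt0) !(exprzE t0) -?exprnP.
all: have := expfz_neq0 i nt0; have := expfz_neq0 j nt0.
all: move: ((- t) ^ i) ((- t) ^ j) => ni nj nj0 ni0.
all: rewrite exprS; have := expf_neq0 n t0; move: (t ^+ n) => w w0.
all: qfield t0 t_root.
Qed.

End Star.

(** * Orthogonality *)

Section GaussRatio.
Variables (F : fieldType) (t : F).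
Hypothesis t0 : t != 0.
Hypothesis t_root : forall n, t ^+ 2 ^+ n.+1 != 1.

Lemma gauss_ratio n (i : int) :
  qnum t (i + 1) * gauss t n (i + 1) = qnum t (n%:Z - i) * gauss t n i.
Proof.
elim: n i => [|n IHn] i /=.
  have [->|i0] := eqVneq i 0; first by rewrite /= subrr qnum0 mul0r mulr0.
  have [i1|_] := eqVneq (i + 1) 0; last by rewrite !mulr0.
  by rewrite i1 qnum0 mul0r mulr0.
have := IHn (i - 1); rewrite subrK => ratio.
have -> : n.+1%:Z - i = n%:Z - (i - 1) by lia.
rewrite addrK [RHS]mulrDr -ratio !mulrDr mulrCA IHn.
have key : (t ^ (i + 1)) ^- 2 * qnum t (n%:Z - i) + qnum t (i + 1)
    = qnum t (n%:Z - (i - 1)) * (t ^ i) ^- 2 + qnum t i.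
  by qfield t0 t_root.
by rewrite mulrA -mulrDl key; ring.
Qed.

End GaussRatio.

Section Orthogonality.
Variables (C : numClosedFieldType) (A : algType C) (star : A -> A).
Hypothesis star_lin : forall k x y, star (k *: x + y) = k^* *: star x + star y.
Variables (t : C) (a b c d s : A).
Hypothesis t0 : t != 0.
Hypothesis t_root : forall n, t ^+ 2 ^+ n.+1 != 1.
Hypothesis t_real : t^* = t.
Hypothesis rel : qSL2 t a b c d.
Hypothesis starM : forall x y, star (x * y) = star y * star x.
Hypothesis star1 : star 1 = 1.
Hypothesis star_a : star a = d.
Hypothesis star_b : star b = - t *: c.
Hypothesis star_c : star c = - t^-1 *: b.
Hypothesis star_d : star d = a.

Local Notation K := (qmx t a b c d).
Local Notation qn := (qnum t).
Local Notation G := (gauss t).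

Variables (h : {scalar A}) (w : nat -> C).
Hypothesis hK : forall n i j e,
  h (K n i j * s ^+ e) = w e * [&& n == 0%N, i == 0 & j == 0]%:R.

Definition qmx_norm n (i j : int) : C :=
  (t ^ j / t ^ n%:Z) ^+ 2 * G n i * G n j / qn n.+1.

(** The weight [w] stays arbitrary because the result serves both [h] (weight 1) and the twisted
    functional (weight 1 + (-1)^e). *)
Lemma qmx_orthogonal n n' i j i' j' e :
  h (K n i j * star (K n' i' j') * s ^+ e)
    = w e * [&& n == n', i == i' & j == j']%:R * qmx_norm n i j.
Proof.
elim: n' n i j i' j' => [|n' IHn] n i j i' j'.
  rewrite [in LHS]/=; have [i'0|i'0] := eqVneq i' 0; last first.
    rewrite /= (star0 star_lin) mulr0 mul0r linear0.
    have [->|] := eqVneq i i'; last by rewrite andbF mulr0 mul0r.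
    have [->|] := eqVneq n 0%N; last by rewrite mulr0 mul0r.
    by rewrite /qmx_norm /= (negPf i'0) !(mulr0, mul0r).
  have [j'0|j'0] := eqVneq j' 0; last first.
    rewrite /= (star0 star_lin) mulr0 mul0r linear0.
    have [->|] := eqVneq j j'; last by rewrite !andbF mulr0 mul0r.
    have [->|] := eqVneq n 0%N; last by rewrite mulr0 mul0r.
    by rewrite /qmx_norm /= (negPf j'0) !(mulr0, mul0r).
  rewrite i'0 j'0 /= star1 mulr1 hK.
  have [->|] := eqVneq n 0%N; last by rewrite !(mulr0, mul0r).
  have [->|] := eqVneq i 0; last by rewrite !(mulr0, mul0r).
  have [->|] := eqVneq j 0; last by rewrite !(mulr0, mul0r).
  by rewrite /qmx_norm /= (qnum1 t_root) expr0z !(invr1, expr1n, mulr1).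
rewrite (qmxS_star star_lin t0 t_real) //.
have -> : K n i j * ((t ^ i' * t ^ j')^-1 *: (d * star (K n' i' j'))
    - (t / t ^ i') *: (c * star (K n' i' (j' - 1)))
    - (t * t ^ j')^-1 *: (b * star (K n' (i' - 1) j'))
    + a * star (K n' (i' - 1) (j' - 1))) * s ^+ e
  = (t ^ i' * t ^ j')^-1 *: (K n i j * d * star (K n' i' j') * s ^+ e)
    - (t / t ^ i') *: (K n i j * c * star (K n' i' (j' - 1)) * s ^+ e)
    - (t * t ^ j')^-1 *: (K n i j * b * star (K n' (i' - 1) j') * s ^+ e)
    + K n i j * a * star (K n' (i' - 1) (j' - 1)) * s ^+ e.
  by rewrite !(mulrDr, mulrN, mulrDl, mulNr, =^~ scalerAl, =^~ scalerAr) !mulrA.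
rewrite qmx_mul_d // qmx_mul_c // qmx_mul_b // qmx_mul_a //.
have hZ k x : h (k *: x) = k * h x by rewrite linearZ.
rewrite !(mulrDl, mulNr) -!scalerAl !(linearD, linearN, hZ) !IHn.
have shiftB (k l : int) : (k - 1 == l - 1) = (k == l) by lia.
have shiftD (k l : int) : (k == l - 1) = (k + 1 == l) by lia.
rewrite !shiftB !shiftD.
have N0 m : qn m.+1 != 0 by apply: qnum_neq0.
(* The contributions of K^(n+1) cancel, those of K^(n-1) give the norm.       *)
pose up := (t ^ i' * t ^ j')^-1 * (qn (i + 1) * qn (j + 1) / qn n.+1 ^+ 2
        * qmx_norm n.+1 (i + 1) (j + 1))
    - t / t ^ i' * (qn (i + 1) * qn (n.+1%:Z - j) / (qn n.+1 ^+ 2 * t ^ j)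
        * qmx_norm n.+1 (i + 1) j)
    - (t * t ^ j')^-1 * (qn (j + 1) * qn (n.+1%:Z - i) / (qn n.+1 ^+ 2 * t ^ i)
        * qmx_norm n.+1 i (j + 1))
    + qn (n.+1%:Z - i) * qn (n.+1%:Z - j) / (qn n.+1 ^+ 2 * t ^ i * t ^ j)
        * qmx_norm n.+1 i j.
pose down := (t ^ i' * t ^ j')^-1 * (qn n / (qn n.+1 * t ^ (i + 1) * t ^ (j + 1))
        * qmx_norm n.-1 i j)
    + t / t ^ i' * (qn n / (qn n.+1 * t ^ (i + 1)) * qmx_norm n.-1 i (j - 1))
    + (t * t ^ j')^-1 * (qn n / (qn n.+1 * t ^ (j + 1)) * qmx_norm n.-1 (i - 1) j)
    + qn n / qn n.+1 * qmx_norm n.-1 (i - 1) (j - 1).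
(* At these indices [up] is a multiple of the product of the two differences in [gauss_ratio], one
   in i and one in j. *)
have up0 : [&& n.+1 == n', i + 1 == i' & j + 1 == j'] -> up = 0.
  rewrite /up => /and3P[_ /eqP <- /eqP <-].
  have := gauss_ratio t0 t_root n.+1 i; have := gauss_ratio t0 t_root n.+1 j.
  rewrite /qmx_norm.
  move: (G n.+1 (i + 1)) (G n.+1 i) (G n.+1 (j + 1)) (G n.+1 j).
  move: (qn (i + 1)) (qn (j + 1)) (qn (n.+1%:Z - i)) (qn (n.+1%:Z - j)).
  move=> qi qj qni qnj gi' gi gj' gj eqj eqi.
  rewrite !(exprzE t0).
  have := N0 n; have := N0 n.+1; move: (qn n.+1) (qn n.+2) => q1 q2 q20 q10.
  have := expfz_neq0 i t0; have := expfz_neq0 j t0; have := expfz_neq0 n t0.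
  move: (t ^ i) (t ^ j) (t ^ n) => u v x x0 v0 u0.
  transitivity ((t * x) ^- 2 / (q1 ^+ 2 * q2) * (v / u)
     * (qi * gi' - qni * gi) * (qj * gj' - qnj * gj)); last first.
    by rewrite eqi eqj !subrr mulr0.
  by field; rewrite t0 u0 v0 x0 q10 q20.
(* The four terms are the expanded product of Pascal's rule for the two Gaussians. *)
have downE : [&& n == n'.+1, i == i' & j == j'] -> down = qmx_norm n i j.
  rewrite /down => /and3P[/eqP -> /eqP <- /eqP <-]; rewrite /qmx_norm /=.
  move: (G n' i) (G n' (i - 1)) (G n' j) (G n' (j - 1)) => gi gi' gj gj'.
  rewrite !(exprzE t0).
  have := N0 n'; have := N0 n'.+1; move: (qn n'.+1) (qn n'.+2) => q1 q2 q20 q10.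
  have := expfz_neq0 i t0; have := expfz_neq0 j t0; have := expfz_neq0 n' t0.
  move: (t ^ i) (t ^ j) (t ^ n') => u v x x0 v0 u0.
  by field; rewrite t0 u0 v0 x0 q10 q20.
transitivity (w e * [&& n.+1 == n', i + 1 == i' & j + 1 == j']%:R * up
              + w e * [&& n.-1 == n', i == i' & j == j']%:R * down).
  by rewrite /up /down; ring.
have -> : w e * [&& n.+1 == n', i + 1 == i' & j + 1 == j']%:R * up = 0.
  by case: (boolP [&& _, _ & _]) => [/up0 ->|_]; rewrite !(mulr0, mul0r).
(* For n = 0 the spurious K^0 term coming from the predecessor has coefficient [0] = 0. *)
rewrite add0r; case: n => [|n] in down {up up0} downE *.
  by rewrite /down qnum0 !(mul0r, mulr0, addr0).
rewrite eqSS in downE *.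
by case: (boolP [&& _, _ & _]) downE => [_ ->|_ _]; rewrite // !(mulr0, mul0r).
Qed.

End Orthogonality.

Section GaussBinomials.
Variables (F : fieldType) (t : F).
Hypothesis t0 : t != 0.
Hypothesis t_root : forall n, t ^+ 2 ^+ n.+1 != 1.

Lemma gauss0 n : gauss t n 0 = 1.
Proof.
by elim: n => //= n ->; rewrite gauss_out // expr0z expr1n invr1 mulr1 addr0.
Qed.

Lemma gauss_absorb n (i : int) :
  qnum t (i + 1) * gauss t n.+1 (i + 1) = qnum t n.+1 * gauss t n i.
Proof.
rewrite /= addrK mulrDr mulrCA gauss_ratio // mulrA -mulrDl; congr (_ * _).
by qfield t0 t_root.
Qed.

Lemma gauss_neq0 (n i : nat) : (i <= n)%N -> gauss t n i != 0.
Proof.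
elim: n i => [|n IHn] [|i] // le_in; rewrite ?gauss0 ?oner_eq0 //.
have q_n := qnum_neq0 t_root n.
have : qnum t n.+1 * gauss t n i != 0 by rewrite mulf_neq0 ?IHn.
rewrite -gauss_absorb (_ : i%:Z + 1 = i.+1); last by lia.
by apply: contraNneq => ->; rewrite mulr0.
Qed.

End GaussBinomials.

Definition tri_sign (C : pzRingType) (n : nat) : C := (-1) ^+ 'C(n, 2).

Lemma tri_signS (C : pzRingType) n : tri_sign C n.+1 = tri_sign C n * (-1) ^+ n.
Proof. by rewrite /tri_sign binS bin1 exprD. Qed.

(** * Matrix elements *)

Section Desuperization.
Variables (C : numClosedFieldType) (t : C) (A : algType C) (a b c d s : A).
Hypothesis t0 : t != 0.
Hypothesis t_root : forall n, t ^+ 2 ^+ n.+1 != 1.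
Hypothesis rel : Asigma_relations t a b c d s.

Lemma sigma_sqr : s * s = 1.
Proof. by have := rel_ss rel; rewrite expr2. Qed.

(** Since [s] anticommutes with [b], the factor [s] on [c] turns bc = - cb into commutation.
    Multiplying ad + tbc = s by [s] on the right gives determinant 1 up to the sign absorbed in
    [- b]. *)
Lemma Asigma_qSL2 : qSL2 t a (- b) (c * s) (d * s).
Proof.
have ss := sigma_sqr.
case: rel => ab ac bc bd cd ad sa sd sb sc _ det.
have da : d * a = s - t^-1 *: (b * c).
  rewrite -det -[LHS](subKr (a * d)) ad scalerBl; apply/esym.
  by linear_combination C [:: a * d; b * c]; ring.
split.
- by rewrite mulrN ab mulNr scalerN.
- by rewrite mulrA ac -scalerAl -mulrA -sa mulrA.
- by rewrite mulNr mulrN -[c * s * b]mulrA sb mulrN !mulrA bc mulNr.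
- rewrite mulNr mulrA bd -scalerAl scaleNr opprK mulrN -[d * s * b]mulrA sb.
  by rewrite mulrN opprK mulrA.
- rewrite -mulrA [s * _]mulrA sd -[d * s * s]mulrA ss mulr1 cd.
  by rewrite -mulrA [s * _]mulrA sc mulNr -mulrA ss mulr1 mulrN scaleNr scalerN.
- rewrite mulrA -[a * d](addrK (t *: (b * c))) det mulrBl ss -scalerAl.
  by rewrite mulNr mulrA scalerN.
- by rewrite -mulrA sa mulrA da mulrBl ss -scalerAl mulNr mulrA scalerN.
Qed.

Local Notation K := (qmx t a (- b) (c * s) (d * s)).

(** In the recursion the index sum i + j grows by 0, 1, 1, 2 along the four generators; exactly the
    two odd ones anticommute with [s]. *)
Lemma qmx_sigma n i j : s * K n i j = (-1) ^ (i + j) *: (K n i j * s).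
Proof.
have n1 : (-1 : C) != 0 by rewrite oppr_eq0 oner_eq0.
case: (rel) => _ _ _ _ _ _ sa sd sb sc _ _.
elim: n i j => [|n IHn] i j.
  rewrite /=; have [->|_] := eqVneq i 0; last by rewrite mul0r mulr0 scaler0.
  have [->|_] := eqVneq j 0; last by rewrite /= mul0r mulr0 scaler0.
  by rewrite mulr1 mul1r scale1r.
rewrite qmxS !(mulrDr, mulrDl) -!scalerAl -!scalerAr !(mulrA s) !IHn.
rewrite -!scalerAl -!mulrA sa (mulrA s d) sd -mulrA (mulrA s c) sc !mulrN sb.
rewrite !mulNr -mulrA !(exprzE n1) !mulrN invrN1.
linear_combination C [:: K n i j * (a * s); K n i (j - 1) * (b * s);
  K n (i - 1) j * (c * (s * s)); K n (i - 1) (j - 1) * (d * (s * s))].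
all: have := expfz_neq0 i t0; have := expfz_neq0 j t0.
all: move: (t ^ i) (t ^ j) => u v v0 u0.
all: ring.
Qed.

(* The matrix elements for the basis a^(n-i) c^i without square roots; the    *)
(* sign comes from moving powers of s and from b = - (- b).                   *)
Definition corep (n i j : nat) : A :=
  (tri_sign C j.+1 * tri_sign C i * (-1) ^+ (i * j) / gauss t n i) *: (K n i j * s ^+ i).

Lemma c_sigmaX i : c * s ^+ i = (-1) ^+ i *: (s ^+ i * c).
Proof.
elim: i => [|i IHi]; first by rewrite !expr0 mulr1 mul1r scale1r.
rewrite !exprSr mulrA IHi -scalerAl -!mulrA (rel_sc rel) mulrN1 mulrN scaleNr.
by rewrite scalerN opprK.
Qed.

Lemma d_sigmaX i : d * s ^+ i = s ^+ i * d.
Proof. by apply/commrX/esym; apply: rel_sd rel. Qed.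

Lemma corep_out n i : (i <= n)%N -> corep n i n.+1 = 0.
Proof. by move=> le_in; rewrite /corep qmx_out ?mul0r ?scaler0 //; lia. Qed.

(** This and the three lemmas like it compare coefficients when an expansion of Delta is multiplied
    by Delta(a) or Delta(c). The power of t comes from moving [a] left across powers of [c], the
    sign from moving an odd generator across an odd power of [c]. *)
Lemma corep_row0 n j : corep n.+1 0 j.+1 =
  t ^- j.+1 *: (corep n 0 j.+1 * a) + (-1) ^+ j *: (corep n 0 j * b).
Proof.
have [+ _] := qmx_rows t0 t_root Asigma_qSL2 n 0 j.+1%:Z.
rewrite subr0 expr0z mul1r -[0]/(Posz 0) => /(scalerI (qnum_neq0 t_root n)) E.
rewrite /corep E !gauss0 !divr1 !mul0n !mulr1.
rewrite (_ : j.+1%:Z - 1 = j); last by lia.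
rewrite mulrN -!scalerAl (tri_signS _ j.+1) [_ ^+ j.+1]exprS.
move: (tri_sign C j.+1) ((-1) ^+ j) => f e.
linear_combination C [:: K n 0%N j.+1 * a; K n 0%N j * b].
  by rewrite -exprnP; ring.
by ring.
Qed.

Lemma corep_row00 n : corep n.+1 0 0 = corep n 0 0 * a.
Proof.
have [+ _] := qmx_rows t0 t_root Asigma_qSL2 n 0 0.
rewrite subr0 expr0z mul1r -[0]/(Posz 0) => /(scalerI (qnum_neq0 t_root n)) E.
rewrite /corep E !gauss0 sub0r [K n 0 (- 1)]qmx_out ?mul0r // invr1.
by rewrite addr0 scale1r expr0 !mulr1 scalerAl.
Qed.

Lemma corep_rowS n i j : (i <= n)%N -> corep n.+1 i.+1 j.+1 =
  ((-1) ^+ j.+1 * t ^- j.+1) *: (corep n i j.+1 * c) + corep n i j * d.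
Proof.
move=> le_in.
have [_ +] := qmx_rows t0 t_root Asigma_qSL2 n i.+1%:Z j.+1%:Z.
have := gauss_absorb t0 t_root n i.
have Si k : k.+1%:Z - 1 = k by lia.
rewrite !Si (_ : i%:Z + 1 = i.+1); last by lia.
have qi := qnum_neq0 t_root i; have qn := qnum_neq0 t_root n.
have G0 := gauss_neq0 t0 t_root le_in.
have G1 : gauss t n.+1 i.+1 != 0 by apply: gauss_neq0.
move=> EG EK.
(* Dividing by the Gaussian turns the ratio [n+1]/[i+1] into a mere change of degree, by
   [gauss_absorb]. *)
have {}EK : (gauss t n.+1 i.+1)^-1 *: K n.+1 i.+1 j.+1
    = (gauss t n i)^-1 *: ((t ^ j.+1)^-1 *: (K n i j.+1 * (c * s)) + K n i j * (d * s)).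
  apply: (scalerI qi); rewrite [LHS]scalerA mulrC -scalerA EK !scalerA; congr (_ *: _).
  by apply: (canRL (mulfK G0)); rewrite -mulrA -EG mulrC mulfK.
have sK : s * s ^+ i.+1 = s ^+ i by rewrite exprS mulrA sigma_sqr mul1r.
have -> : corep n.+1 i.+1 j.+1
    = (tri_sign C j.+2 * tri_sign C i.+1 * (-1) ^+ (i.+1 * j.+1))
      *: ((gauss t n.+1 i.+1)^-1 *: K n.+1 i.+1 j.+1 * s ^+ i.+1).
  by rewrite -scalerAl scalerA.
rewrite EK -scalerAl mulrDl -!scalerAl -!mulrA sK c_sigmaX d_sigmaX /corep.
rewrite -scalerAr -exprnP (tri_signS _ j.+1) (tri_signS _ i).
rewrite mulSn (mulnS i) !exprD.
have := sqrr_sign C i; have := sqrr_sign C j.+1.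
move: ((-1) ^+ i) ((-1) ^+ j.+1) ((-1) ^+ (i * j)) => ei ej eij ej2 ei2.
have := expf_neq0 j.+1 t0; move: (t ^+ j.+1) => u u0.
move: (tri_sign C j.+1) (tri_sign C i) => fj fi.
linear_combination C [:: K n i j * (s ^+ i * d); K n i j.+1 * (s ^+ i * c)].
  transitivity (ei ^+ 2 * ei * eij * fi * fj * ej ^+ 2 / (u * gauss t n i)).
    by field; rewrite u0 G0.
  by rewrite ei2; field; rewrite u0 G0.
transitivity (ei ^+ 2 * eij * fi * fj * ej ^+ 2 / gauss t n i).
  by field; rewrite u0 G0.
by rewrite ei2 ej2; field; rewrite u0 G0.
Qed.

Lemma corep_rowS0 n i : (i <= n)%N -> corep n.+1 i.+1 0 = corep n i 0 * c.
Proof.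
move=> le_in.
have [_ +] := qmx_rows t0 t_root Asigma_qSL2 n i.+1%:Z 0.
have := gauss_absorb t0 t_root n i.
have -> : i%:Z + 1 = i.+1 by lia.
have -> : i.+1%:Z - 1 = i by lia.
have qi := qnum_neq0 t_root i; have qn := qnum_neq0 t_root n.
have G0 := gauss_neq0 t0 t_root le_in.
have G1 : gauss t n.+1 i.+1 != 0 by apply: gauss_neq0.
rewrite sub0r [K n i (- 1)]qmx_out ?orbT // mul0r addr0 expr0z invr1 scale1r.
rewrite -[0]/(Posz 0) => EG EK.
have {}EK : (gauss t n.+1 i.+1)^-1 *: K n.+1 i.+1 0%N
    = (gauss t n i)^-1 *: (K n i 0%N * (c * s)).
  apply: (scalerI qi); rewrite [LHS]scalerA mulrC -scalerA EK !scalerA; congr (_ *: _).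
  by apply: (canRL (mulfK G0)); rewrite -mulrA -EG mulrC mulfK.
have sK : s * s ^+ i.+1 = s ^+ i by rewrite exprS mulrA sigma_sqr mul1r.
rewrite /corep !muln0 expr0 !mulr1 -scalerA [in LHS]scalerAl EK.
rewrite -!scalerAl -!mulrA sK c_sigmaX -scalerAr (tri_signS _ i) !scalerA.
congr (_ *: _); have := sqrr_sign C i; move: ((-1) ^+ i) => ei ei2.
transitivity (ei ^+ 2 * tri_sign C 1 * tri_sign C i / gauss t n i).
  by ring.
by rewrite ei2 mul1r mulrA.
Qed.

Lemma corep0 : corep 0 0 0 = 1.
Proof.
rewrite /corep (gauss0 _ 0%N) divr1 /tri_sign !bin_small // !expr0 !mulr1 scale1r.
by [].
Qed.

End Desuperization.

(** * The coproduct of the row vectors a^(n-j) c^j *)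

Section Coproduct.
Variables (C : numClosedFieldType) (t : C) (A : algType C) (a b c d s : A).
Hypothesis t0 : t != 0.
Hypothesis t_root : forall n, t ^+ 2 ^+ n.+1 != 1.
Hypothesis rel : Asigma_relations t a b c d s.

Local Notation parity := (Asigma_parity a b c d s).
Local Notation M := (corep t a b c d s).
Local Notation x n j := (a ^+ (n - j) * c ^+ j).

Lemma parity_exp p y n : parity p y -> parity (p && odd n) (y ^+ n).
Proof.
move=> py; elim: n => [|n IHn]; first by rewrite andbF; apply: parity_1.
rewrite exprS; have -> : p && odd n.+1 = p (+) (p && odd n).
  by rewrite oddS; case: p {py IHn}; case: (odd n).
exact: parity_mul.
Qed.

Lemma parity_row n j : parity (odd j) (x n j).
Proof.
have -> : odd j = (false && odd (n - j)) (+) (true && odd j) by [].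
by apply: parity_mul; apply: parity_exp; [apply: parity_a | apply: parity_c].
Qed.

Lemma c_expr_a j : c ^+ j * a = t ^- j *: (a * c ^+ j).
Proof.
elim: j => [|j IHj]; first by rewrite !expr0 invr1 scale1r mulr1 mul1r.
have ca : c * a = t^-1 *: (a * c) by rewrite (rel_ac rel) scalerA mulVf ?scale1r.
rewrite [in LHS]exprSr -[LHS]mulrA ca -scalerAr [c ^+ j * _]mulrA IHj -scalerAl.
by rewrite scalerA -mulrA -exprSr [t ^+ j.+1]exprS invfM.
Qed.

Lemma row_mul_a n j : (j <= n)%N -> x n j * a = t ^- j *: x n.+1 j.
Proof. by move=> le_jn; rewrite -mulrA c_expr_a -scalerAr mulrA -exprSr -subSn. Qed.

Lemma row_mul_c n j : x n j * c = x n.+1 j.+1.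
Proof. by rewrite -mulrA -exprSr subSS. Qed.

Variables (T : algType C) (tens : A -> A -> T).
Hypothesis hT : is_graded_tensor parity tens.

Lemma tensDl u u' v : tens (u + u') v = tens u v + tens u' v.
Proof.
by have [/(_ v 1 u u') + _] := tens_bilinear hT; rewrite !scale1r.
Qed.

Lemma tensZl k u v : tens (k *: u) v = k *: tens u v.
Proof.
have [lin _] := tens_bilinear hT.
have t0v : tens 0 v = 0.
  have := lin v (-1) 0 0; rewrite scaler0 addr0 scaleN1r addNr => ->.
  by [].
by have := lin v k u 0; rewrite t0v !addr0.
Qed.

Lemma tensZr k u v : tens u (k *: v) = k *: tens u v.
Proof.
have [_ lin] := tens_bilinear hT.
have tu0 : tens u 0 = 0.
  by have := lin u (-1) 0 0; rewrite scaler0 addr0 scaleN1r addNr.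
by have := lin u k v 0; rewrite tu0 !addr0.
Qed.

Lemma tens0l v : tens 0 v = 0.
Proof. by rewrite -[0 in LHS](scale0r 0) tensZl scale0r. Qed.

(** Multiplication by [a] keeps the index j and multiplication by [c] raises it; [X n.+1 = 0]
    supplies the missing last term. *)
Lemma tens_row_mul n (X Y Z : nat -> A) (y z : A) :
  X n.+1 = 0 -> Z 0%N = X 0%N -> (forall j, Z j.+1 = X j.+1 + Y j) ->
  \sum_(j < n.+1) (tens (X j) (x n.+1 j) + tens (Y j) (x n.+1 j.+1))
  = \sum_(j < n.+2) tens (Z j) (x n.+1 j).
Proof.
move=> X0 Z0 ZS; rewrite big_split /= [RHS]big_ord_recl /= Z0.
have -> : \sum_(j < n.+1) tens (Z (bump 0 j)) (x n.+1 (bump 0 j))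
    = \sum_(j < n.+1) (tens (X j.+1) (x n.+1 j.+1) + tens (Y j) (x n.+1 j.+1)).
  by apply: eq_bigr => j _; rewrite [bump 0 j]add1n ZS tensDl.
rewrite big_split /= addrA; congr (_ + _).
rewrite big_ord_recl [in RHS]big_ord_recr /= X0 tens0l addr0; congr (_ + _).
Qed.

Variable Delta : {lrmorphism A -> T}.
Hypothesis hDelta : is_coproduct tens a b c d s Delta.

(** Delta is multiplicative, and a row vector of degree n + 1 is one of degree n times [a] (for i =
    0) or times [c] (for i > 0). *)
Lemma coproduct_row n i : (i <= n)%N ->
  Delta (x n i) = \sum_(j < n.+1) tens (M n i j) (x n j).
Proof.
elim: n i => [|n IHn] [|i] // le_in.
- rewrite big_ord1 corep0 !expr0 mulr1 rmorph1; exact/esym/(tens_one hT).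
- have -> : x n.+1 0 = x n 0 * a by rewrite row_mul_a // expr0 invr1 scale1r.
  rewrite rmorphM /= IHn // (Delta_a hDelta) mulr_suml.
  rewrite -(@tens_row_mul n (fun j => t ^- j *: (M n 0 j * a))
    (fun j => (-1) ^+ j *: (M n 0 j * b)) (M n.+1 0)) //.
  + apply: eq_bigr => j _; rewrite mulrDr.
    rewrite (tens_mul hT _ _ (parity_row n j) (parity_a a b c d s)) andbF expr0 scale1r.
    rewrite (tens_mul hT _ _ (parity_row n j) (parity_b a b c d s)) andbT signr_odd.
    by rewrite row_mul_a -1?ltnS // row_mul_c tensZr !tensZl.
  + by rewrite corep_out // mul0r scaler0.
  + by rewrite corep_row00 // expr0 invr1 scale1r.
  + by move=> j; rewrite corep_row0.
- rewrite -row_mul_c rmorphM /= IHn // (Delta_c hDelta) mulr_suml.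
  rewrite -(@tens_row_mul n (fun j => ((-1) ^+ j * t ^- j) *: (M n i j * c))
    (fun j => M n i j * d) (M n.+1 i.+1)) //.
  + apply: eq_bigr => j _; rewrite mulrDr.
    rewrite (tens_mul hT _ _ (parity_row n j) (parity_c a b c d s)) andbT signr_odd.
    rewrite (tens_mul hT _ _ (parity_row n j) (parity_d a b c d s)) andbF expr0 scale1r.
    by rewrite row_mul_a -1?ltnS // row_mul_c tensZr !tensZl scalerA.
  + by rewrite corep_out // mul0r scaler0.
  + by rewrite corep_rowS0 // expr0 invr1 mulr1 scale1r.
  + by move=> j; rewrite corep_rowS.
Qed.

End Coproduct.

(** * Uniqueness of the expansion along row vectors *)

Section TruncatedRepresentation.
Variables (C : numClosedFieldType) (t : C) (n : nat).
Hypothesis t0 : t != 0.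

(* The quotient by [b = 0] acts on the truncated polynomials: [c] raises the  *)
(* degree and [a], [d], [s] are diagonal.                                     *)
Let ra : 'M[C]_n.+1 := diag_mx (\row_i t ^- i).
Let rc : 'M[C]_n.+1 := \matrix_(i, j) (j == i.+1 :> nat)%:R.
Let rd : 'M[C]_n.+1 := diag_mx (\row_i (- t) ^+ i).
Let rs : 'M[C]_n.+1 := diag_mx (\row_i (-1) ^+ i).

Lemma truncated_relations : Asigma_relations t ra 0 rc rd rs.
Proof.
split; rewrite ?(mul0r, mulr0, scaler0, oppr0, subr0, addr0) //.
- apply/matrixP => i j; rewrite -!mulmxE mul_diag_mx mul_mx_diag !mxE.
  have [->|_] := eqVneq (j : nat) i.+1; last by rewrite mulr0 mul0r mulr0.
  by rewrite mulr1 mul1r exprS invfM mulVKf.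
- apply/matrixP => i j; rewrite -!mulmxE mul_diag_mx mul_mx_diag !mxE.
  have [->|_] := eqVneq (j : nat) i.+1; last by rewrite mulr0 mul0r mulr0.
  by rewrite mulr1 mul1r exprS.
- by rewrite -!mulmxE /ra /rd diag_mxC subrr.
- by rewrite -!mulmxE /rs /ra diag_mxC.
- by rewrite -!mulmxE /rs /rd diag_mxC.
- apply/matrixP => i j; rewrite -!mulmxE mul_diag_mx mul_mx_diag !mxE.
  have [->|_] := eqVneq (j : nat) i.+1; last by rewrite mulr0 mul0r oppr0.
  by rewrite mulr1 mul1r exprS mulN1r opprK.
- apply/matrixP => i j; rewrite expr2 -mulmxE mul_diag_mx !mxE.
  by rewrite mulrnAr -expr2 sqrr_sign.
- apply/matrixP => i j; rewrite -mulmxE mul_diag_mx !mxE mulrnAr.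
  by rewrite -exprVn -exprMn mulrN mulVf.
Qed.

(** The first diagonal entry of [ra] is 1, so its powers preserve the first row, and each factor
    [rc] shifts the unit vector by one. *)
Lemma truncated_row k j (l : 'I_n.+1) :
  (ra ^+ k * rc ^+ j) ord0 l = (l == j :> nat)%:R.
Proof.
have cX j' (i l' : 'I_n.+1) : (rc ^+ j') i l' = (l' == (i + j')%N :> nat)%:R.
  elim: j' i => [|j' IHj] i; first by rewrite expr0 mxE addn0 eq_sym.
  rewrite exprS -mulmxE mxE.
  have [lt_i|ge_i] := ltnP i.+1 n.+1.
    rewrite (bigD1 (Ordinal lt_i)) //= big1 => [|l2 ne_l2].
      by rewrite mxE eqxx mul1r addr0 IHj addSnnS.
    by rewrite mxE (_ : (l2 == i.+1 :> nat) = false) ?mul0r //; apply: negbTE.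
  rewrite big1 => [|l2 _].
    rewrite (_ : (l' == (i + j'.+1)%N :> nat) = false) //.
    by have := ltn_ord l'; lia.
  rewrite mxE (_ : (l2 == i.+1 :> nat) = false) ?mul0r //.
  by have := ltn_ord l2; lia.
elim: k => [|k IHk]; first by rewrite expr0 mul1r cX.
rewrite exprS -mulrA -mulmxE mul_diag_mx -IHk.
by rewrite mxE [(\row_i _) _ _]mxE expr0 invr1 mul1r.
Qed.

End TruncatedRepresentation.

Section RowUniqueness.
Variables (C : numClosedFieldType) (t : C) (A : algType C) (a b c d s : A).
Hypothesis t0 : t != 0.
Hypothesis hA : is_Asigma t a b c d s.
Variables (T : algType C) (tens : A -> A -> T).
Hypothesis hT : is_graded_tensor (Asigma_parity a b c d s) tens.

(** The map sending u (x) v to rho(v)_(0,l) u works: by [truncated_row], the first row of the image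
    of a^(n-j) c^j is the j-th unit vector. *)
Lemma row_coefficient n (l : 'I_n.+1) : exists g : {linear T -> A},
  forall (u : A) (j : 'I_n.+1),
    g (tens u (a ^+ (n - j) * c ^+ j)) = (l == j)%:R *: u.
Proof.
have [rho [ra rb rc rd rs]] := Asigma_univ hA (truncated_relations n t0).
have bil : bilinear_map (fun u v => (rho v) ord0 l *: u).
  split=> [v k u u'|u k v v'].
    by rewrite scalerDr !scalerA mulrC.
  by rewrite linearP /= !mxE scalerDl scalerA.
have [g gE] := tens_univ hT bil.
exists g => u j.
by rewrite gE rmorphM !rmorphXn /= ra rc truncated_row.
Qed.

Lemma row_unique n (u v : 'I_n.+1 -> A) :
  \sum_j tens (u j) (a ^+ (n - j) * c ^+ j)
    = \sum_j tens (v j) (a ^+ (n - j) * c ^+ j) -> u =1 v.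
Proof.
move=> eq_uv l; have [g gE] := row_coefficient l.
have sumE (w : 'I_n.+1 -> A) : g (\sum_j tens (w j) (a ^+ (n - j) * c ^+ j)) = w l.
  rewrite linear_sum (bigD1 l) //= gE eqxx scale1r big1 ?addr0 // => j.
  by rewrite gE eq_sym => /negPf ->; rewrite scale0r.
by rewrite -(sumE u) eq_uv sumE.
Qed.

End RowUniqueness.

Section QBinomial.
Variables (C : numClosedFieldType) (t : C).
Hypothesis t0 : t != 0.
Hypothesis t_root : forall n, t ^+ 2 ^+ n.+1 != 1.

Lemma qpochS (u v : C) n : qpoch u v n.+1 = qpoch u v n * (1 - u * v ^+ n).
Proof. exact: big_ord_recr. Qed.

Lemma sub1_exprV_neq0 n : 1 - t ^- 2 * t ^- 2 ^+ n != 0.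
Proof.
by rewrite -exprS exprVn subr_eq0 eq_sym invr_eq1 t_root.
Qed.

Lemma qpoch_neq0 n : qpoch (t ^- 2) (t ^- 2) n != 0.
Proof.
elim: n => [|n IHn]; first by rewrite /qpoch big_ord0 oner_eq0.
by rewrite qpochS mulf_neq0 ?sub1_exprV_neq0.
Qed.

Lemma qbinom_gauss n k : (k <= n)%N -> qbinom (t ^- 2) n k = gauss t n k.
Proof.
elim: n k => [|n IHn] [|k] // le_kn; rewrite ?(gauss0 _ 0%N) ?(gauss0 _ n.+1).
- by rewrite /qbinom /qpoch !big_ord0 mulr1 divr1.
- by rewrite /qbinom subn0 {2}/qpoch big_ord0 mul1r divff // qpoch_neq0.
have absorb := gauss_absorb t0 t_root n k.
have Sk : k%:Z + 1 = k.+1 by lia.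
have qE m : qnum t m.+1 = (1 - t ^- 2 * t ^- 2 ^+ m) / (1 - t ^- 2).
  by rewrite /qnum -exprnP -exprS exprVn -!exprM mulnC.
rewrite Sk !qE -IHn // in absorb.
have p0 : 1 - t ^- 2 != 0 by have := sub1_exprV_neq0 0; rewrite expr0 mulr1.
have := sub1_exprV_neq0 k => pk0.
apply: (mulfI (_ : (1 - t ^- 2 * t ^- 2 ^+ k) / (1 - t ^- 2) != 0)).
  by rewrite mulf_neq0 // invr_neq0.
rewrite absorb /qbinom subSS !qpochS.
have := qpoch_neq0 k; have := qpoch_neq0 (n - k).
move: (qpoch _ _ _) (qpoch _ _ (n - k)) (qpoch _ _ n) => x y z x0 y0.
move: (1 - _) (1 - t ^- 2 * t ^- 2 ^+ n) pk0 => u w u0.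
by field; rewrite x0 y0 t0 u0 (sqr_sub1_neq0 t_root).
Qed.

End QBinomial.

(** * Normalisation constants for real t *)

Section RealParameter.
Variables (C : numClosedFieldType) (t : C).
Hypothesis t0 : t != 0.
Hypothesis t_root : forall n, t ^+ 2 ^+ n.+1 != 1.
Hypothesis t_real : t^* = t.

Lemma gauss_ge0 n i : 0 <= gauss t n i.
Proof.
elim: n i => [|n IHn] i /=; first exact: ler0n.
apply: addr_ge0 => //; apply: mulr_ge0 => //; rewrite invr_ge0 expr2.
by rewrite -{2}(conj_exprz t_real i) mul_conjC_ge0.
Qed.

Definition row_scale n k : C := 'i ^+ k./2 * sqrtC (gauss t n k%:Z).

Lemma row_scale_neq0 n k : (k <= n)%N -> row_scale n k != 0.
Proof.
by move=> le_kn; rewrite mulf_neq0 ?expf_neq0 ?neq0Ci // sqrtC_eq0 gauss_neq0.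
Qed.

Lemma row_scale_norm n k : row_scale n k * (row_scale n k)^* = gauss t n k.
Proof.
rewrite /row_scale rmorphM rmorphXn /= conjCi mulrACA -exprMn mulrN -expr2 sqrCi.
rewrite opprK expr1n mul1r (CrealP _) -?expr2 ?sqrtCK //.
by rewrite ger0_real // sqrtC_ge0 gauss_ge0.
Qed.

Definition entry_scale n i j : C :=
  row_scale n i / row_scale n j
  * (tri_sign C j.+1 * tri_sign C i * (-1) ^+ (i * j) / gauss t n i).

Lemma entry_scale_neq0 n i j : (i <= n)%N -> (j <= n)%N -> entry_scale n i j != 0.
Proof.
move=> le_in le_jn; apply: mulf_neq0.
  by apply: mulf_neq0; rewrite ?invr_neq0 ?row_scale_neq0.
by rewrite /tri_sign !mulf_neq0 ?signr_eq0 // invr_neq0 ?gauss_neq0.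
Qed.

(** Signs have modulus 1 and |[row_scale]|^2 is the Gaussian, which is nonnegative for real t. Hence
    the value is (G_i / G_j) / G_i^2. *)
Lemma entry_scale_norm n i j : (i <= n)%N -> (j <= n)%N ->
  entry_scale n i j * (entry_scale n i j)^* = (gauss t n i * gauss t n j)^-1.
Proof.
move=> le_in le_jn.
have Gi := gauss_neq0 t0 t_root le_in; have Gj := gauss_neq0 t0 t_root le_jn.
have real_sign k : (((-1) ^+ k : C)^*) = (-1) ^+ k by rewrite rmorph_sign.
rewrite /entry_scale /tri_sign.
have := row_scale_norm n i; have := row_scale_norm n j.
have := row_scale_neq0 le_jn; move: (row_scale n i) (row_scale n j) => ri rj rj0 Ej Ei.
have rj'0 : rj^* != 0 by rewrite conjC_eq0.
rewrite !(rmorphM, fmorphV) /= !real_sign (CrealP (ger0_real (gauss_ge0 n i))).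
have := sqrr_sign C 'C(j.+1, 2); have := sqrr_sign C 'C(i, 2).
have := sqrr_sign C (i * j).
move: (ri^*) (rj^*) Ei Ej rj'0 => ri' rj' Ei Ej rj'0.
move: ((-1) ^+ _) ((-1) ^+ _) ((-1) ^+ _) => e1 e2 e3 E1 E2 E3.
transitivity (e1 ^+ 2 * e2 ^+ 2 * e3 ^+ 2 * (ri * ri') / (rj * rj') / gauss t n i ^+ 2).
  by field; rewrite rj0 rj'0 Gi.
by rewrite E1 E2 E3 Ei Ej; field; rewrite Gi Gj.
Qed.

(** The two quantum integers differ by a power of t: [qnum t n.+1] is t^(-n) times [qint t n.+1]. *)
Lemma qint_qnum n (k : int) :
  (t ^ k / t ^ n%:Z) ^+ 2 / qnum t n.+1 = (qint t n.+1)^-1 * t ^ (2 * k - n%:Z).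
Proof.
have tn : t ^+ n != 0 by rewrite expf_neq0.
have tk := expfz_neq0 k t0.
have -> : 2 * k - n%:Z = k + k - n%:Z by lia.
rewrite !(exprzD_neq0 t0) exprzN /qint /qnum -!exprnP [t ^+ n.+1]exprS.
have : (t * t ^+ n) ^+ 2 - 1 != 0.
  by rewrite subr_eq0 -exprS -exprM mulnC exprM t_root.
have := sqr_sub1_neq0 t_root.
move: (t ^+ n) (t ^ k) tn tk => u v u0 v0 t21 tu21.
by field; rewrite t0 u0 t21 tu21.
Qed.

End RealParameter.

Lemma gauss_sym (C : numClosedFieldType) (t : C) n (i : nat) :
  t != 0 -> (forall n, t ^+ 2 ^+ n.+1 != 1) -> (i <= n)%N ->
  gauss t n (n - i)%N = gauss t n i.
Proof.
move=> t0 t_root le_in; rewrite -!qbinom_gauss ?leq_subr //.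
by rewrite /qbinom subKn // mulrC [X in _ / X]mulrC mulrC.
Qed.

Lemma exprB_neq0 (F : fieldType) (x : F) n k :
  x != 0 -> (k <= n)%N -> x ^+ (n - k) = x ^+ n / x ^+ k.
Proof. by move=> x0 le_kn; rewrite -{2}(subnK le_kn) exprD mulfK ?expf_neq0. Qed.

(** * The two pairings of matrix elements *)

Section PeterWeyl.
Variables (C : numClosedFieldType) (t : C) (A : algType C) (a b c d s : A).
Hypothesis t0 : t != 0.
Hypothesis t_root : forall n, t ^+ 2 ^+ n.+1 != 1.
Hypothesis t_real : t^* = t.
Hypothesis hA : is_Asigma t a b c d s.
Variable star : A -> A.
Hypothesis hstar : is_star t a b c d s star.
Variable m : forall n : nat, 'I_n.+1 -> 'I_n.+1 -> A.

Local Notation K := (qmx t a (- b) (c * s) (d * s)).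
Local Notation V := (Mspace s m).

Hypothesis m_qmx : forall n (i j : 'I_n.+1),
  m i j = entry_scale t n i j *: (K n i j * s ^+ i).

Let rel := Asigma_rel hA.
Let star_lin := star_antilinear hstar.
Let starM := star_mul hstar.

Lemma sigmaX_odd e : s ^+ e = s ^+ (odd e).
Proof.
rewrite -[in LHS](odd_double_half e) exprD -mul2n exprM (rel_ss rel) expr1n mulr1.
by [].
Qed.

Lemma star_1 : star 1 = 1.
Proof. by rewrite -(rel_ss rel) expr2 starM (star_s hstar). Qed.

Lemma star_sigmaX e : star (s ^+ e) = s ^+ e.
Proof.
elim: e => [|e IHe]; first by rewrite expr0 star_1.
by rewrite [in LHS]exprS starM IHe (star_s hstar) -exprSr.
Qed.

Lemma star_qSL2 : [/\ star a = d * s, star (- b) = - t *: (c * s),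
  star (c * s) = - t^-1 *: (- b) & star (d * s) = a].
Proof.
split; first exact: star_a hstar.
- by rewrite -scaleN1r (starZ star_lin) rmorphN1 (star_b hstar) scalerA mulN1r.
- rewrite starM (star_s hstar) (star_c hstar) -scalerAr mulrA (rel_sb rel) mulNr.
  by rewrite -mulrA (sigma_sqr rel) mulr1.
- by rewrite starM (star_s hstar) (star_d hstar) mulrA (rel_sa rel) -mulrA
    (sigma_sqr rel) mulr1.
Qed.

Lemma star_qmx n i j :
  star (K n i j) = ((- t) ^ j / (- t) ^ i) *: K n (n%:Z - i) (n%:Z - j).
Proof.
by have [? ? ? ?] := star_qSL2; apply: qmx_star => //; apply: star_1.
Qed.

Lemma sigmaX_qmx e n (i j : nat) :
  s ^+ e * K n i j = (-1) ^+ (e * (i + j)) *: (K n i j * s ^+ e).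
Proof.
elim: e => [|e IHe]; first by rewrite !expr0 mul1r mulr1 scale1r.
rewrite exprS -mulrA IHe -scalerAr mulrA (qmx_sigma t0 rel) -scalerAl scalerA.
by rewrite -[i%:Z + j]PoszD -exprnP -exprD mulSn addnC -mulrA -exprS.
Qed.

Lemma sigmaX_star_qmx e n (i j : nat) :
  s ^+ e * star (K n i j) = (-1) ^+ (e * (i + j)) *: (star (K n i j) * s ^+ e).
Proof.
rewrite -[s ^+ e in RHS]star_sigmaX -starM sigmaX_qmx (starZ star_lin) rmorph_sign.
by rewrite scalerA -expr2 sqrr_sign scale1r starM star_sigmaX.
Qed.

Lemma m_mul_sigma n (i j : 'I_n.+1) e :
  m i j * s ^+ e = entry_scale t n i j *: (K n i j * s ^+ (i + e)).
Proof. by rewrite m_qmx -scalerAl -mulrA -exprD. Qed.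

Lemma star_qmx_nat n (i j : nat) : (i <= n)%N -> (j <= n)%N ->
  star (K n i j) = (t ^+ j / t ^+ i * (-1) ^+ (i + j)) *: K n (n - i)%N (n - j)%N.
Proof.
move=> le_in le_jn; rewrite star_qmx !subzn //; congr (_ *: _).
by rewrite -!exprnP ![(- t) ^+ _]exprNn exprD invfM invr_sign; ring.
Qed.

Lemma qmx_star_nat n (i j : nat) : (i <= n)%N -> (j <= n)%N ->
  K n i j = (t ^+ j / t ^+ i * (-1) ^+ (i + j)) *: star (K n (n - i)%N (n - j)%N).
Proof.
move=> le_in le_jn; rewrite star_qmx_nat ?leq_subr // !subKn // scalerA.
rewrite -[LHS]scale1r; congr (_ *: _).
have -> : (-1) ^+ (n - i + (n - j)) = (-1) ^+ (i + j) :> C.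
  rewrite -signr_odd -[in RHS]signr_odd; congr (_ ^+ nat_of_bool _).
  by lia.
rewrite !exprB_neq0 //.
have := sqrr_sign C (i + j); move: ((-1) ^+ _) => e e2.
have := expf_neq0 n t0; have := expf_neq0 i t0; have := expf_neq0 j t0.
move: (t ^+ n) (t ^+ i) (t ^+ j) => u v x x0 v0 u0.
by rewrite -e2; field; rewrite x0 v0 u0.
Qed.

Section Pairing.
Variables (h : {scalar A}) (w : nat -> C).
Hypothesis hK : forall n i j e,
  h (K n i j * s ^+ e) = w e * [&& n == 0%N, i == 0 & j == 0]%:R.

(** All powers of [s] end up between the two coefficients, with exponent i + i' + e + e'. Moving
    them right across a factor of parity i' + j' gives the sign, since i + i' is even when i =
    i'. *)
Lemma haar_pairing n n' (i j : 'I_n.+1) (i' j' : 'I_n'.+1) (e e' : nat) :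
  h (m i j * s ^+ e * star (m i' j' * s ^+ e'))
    = (-1) ^+ ((e + e') * (i + j)) * w (i + i' + (e + e'))%N
      * ((qint t n.+1)^-1 * t ^ (2 * (j : nat)%:Z - n%:Z))
      * ((n == n') && (i == i' :> nat) && (j == j' :> nat))%:R.
Proof.
have [sa sb sc sd] := star_qSL2.
rewrite !m_mul_sigma (starZ star_lin) starM star_sigmaX -scalerAl -scalerAr scalerA.
rewrite mulrA -[K n i j * _ * _]mulrA -exprD -[K n i j * _ * star _]mulrA sigmaX_star_qmx -scalerAr.
rewrite scalerA linearZ /= mulrA.
rewrite (qmx_orthogonal star_lin t0 t_root t_real (Asigma_qSL2 rel) starM star_1
  sa sb sc sd hK) !eqz_nat andbA.
case: (boolP (_ && _ && _)) => [/andP[/andP[/eqP En /eqP Ei] /eqP Ej]|_]; last first.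
  by rewrite !(mulr0, mul0r).
have le_ord (k : 'I_n.+1) : (k <= n)%N by rewrite -ltnS.
rewrite -Ei -Ej -En entry_scale_norm //.
rewrite addnACA mulnDl addnn -mul2n -mulnA exprD exprM sqrrN !expr1n mul1r.
rewrite -qint_qnum // /qmx_norm !mulr1.
have Gi := gauss_neq0 t0 t_root (le_ord i).
have Gj := gauss_neq0 t0 t_root (le_ord j).
have q0 := qnum_neq0 t_root n.
have tn := expfz_neq0 n t0.
by field; rewrite Gi Gj q0 tn.
Qed.

(** By [star_qmx_nat] and [qmx_star_nat] the star moves from the first factor to the second at
    reflected indices, so [qmx_orthogonal] applies. The signs occur in equal pairs, and t^(2(j-i))
    from the two stars turns the norm factor t^(-2j) into t^(-2i). *)
Lemma haar_pairing_left n n' (i j : 'I_n.+1) (i' j' : 'I_n'.+1) (e e' : nat) :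
  h (star (m i j * s ^+ e) * (m i' j' * s ^+ e'))
    = w (i + i' + (e + e'))%N
      * ((qint t n.+1)^-1 * t ^ (n%:Z - 2 * (i : nat)%:Z))
      * ((n == n') && (i == i' :> nat) && (j == j' :> nat))%:R.
Proof.
have [sa sb sc sd] := star_qSL2.
have le k (l : 'I_k.+1) : (l <= k)%N by rewrite -ltnS.
rewrite !m_mul_sigma (starZ star_lin) starM star_sigmaX -scalerAl -scalerAr scalerA.
rewrite star_qmx_nat // [K n' i' j']qmx_star_nat //.
rewrite -!(scalerAl, scalerAr) !scalerA.
rewrite linearZ /= sigmaX_qmx -scalerAl linearZ /=.
rewrite -[_ * s ^+ _ * (_ * _)]mulrA [s ^+ _ * (_ * _)]mulrA sigmaX_star_qmx.
rewrite -scalerAl -scalerAr linearZ /= -[star _ * s ^+ _ * _]mulrA.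
rewrite -[s ^+ _ * s ^+ _]exprD [K _ _ _ * _]mulrA.
rewrite (qmx_orthogonal star_lin t0 t_root t_real (Asigma_qSL2 rel) starM star_1
  sa sb sc sd hK) !eqz_nat andbA.
have -> : (n == n') && (n - i == n' - i')%N && (n - j == n' - j')%N
    = (n == n') && (i == i' :> nat) && (j == j' :> nat).
  have := le _ i; have := le _ j; have := le _ i'; have := le _ j'; lia.
case: (boolP (_ && _ && _)) => [/andP[/andP[/eqP En /eqP Ei] /eqP Ej]|_]; last first.
  by rewrite !(mulr0, mul0r).
rewrite -Ei -Ej -En [_^* * _]mulrC entry_scale_norm // addnACA.
have -> : n%:Z - 2 * (i : nat)%:Z = 2 * (n - i)%N%:Z - n%:Z.
  by have := le _ i; lia.
rewrite -qint_qnum // /qmx_norm !gauss_sym //.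
have Gi := gauss_neq0 t0 t_root (le _ i).
have Gj := gauss_neq0 t0 t_root (le _ j).
have := sqrr_sign C (i + j); have := sqrr_sign C ((i + e) * (n - i + (n - j))).
have := qnum_neq0 t_root n; have := expf_neq0 n t0.
have := expf_neq0 i t0; have := expf_neq0 j t0.
rewrite -!exprnP !exprB_neq0 //.
move: ((-1) ^+ _) ((-1) ^+ _) (t ^+ j) (t ^+ i) (t ^+ n) => e1 e2 vj vi vn.
move=> tj ti tn q0 E1 E2; rewrite !mulr1.
transitivity (e1 ^+ 2 * e2 ^+ 2 * w (i + i + (e + e'))%N / vi ^+ 2 / qnum t n.+1).
  by field; rewrite Gi Gj tj ti tn q0.
by rewrite E1 E2; field; rewrite ti tn q0.
Qed.

End Pairing.

Lemma qmx_mul_sigma n (i j : 'I_n.+1) e :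
  K n i j * s ^+ e = (entry_scale t n i j)^-1 *: (m i j * s ^+ (i + e)).
Proof.
have le (l : 'I_n.+1) : (l <= n)%N by rewrite -ltnS.
rewrite m_mul_sigma scalerA mulVf ?entry_scale_neq0 // scale1r.
by congr (_ * _); rewrite sigmaX_odd [RHS]sigmaX_odd !oddD addbA addbb.
Qed.

End PeterWeyl.

Lemma qmx_morph (C : numClosedFieldType) (t : C) (A B : algType C)
    (f : {lrmorphism A -> B}) (a b c d : A) n i j :
  f (qmx t a b c d n i j) = qmx t (f a) (f b) (f c) (f d) n i j.
Proof.
elim: n i j => [|n IHn] i j.
  by rewrite /=; case: ifP => _; [exact: rmorph1 | exact: linear0].
have fZ k x : f (k *: x) = k *: f x by exact: linearZZ.
have fD x y : f (x + y) = f x + f y by exact: rmorphD.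
have fM x y : f (x * y) = f x * f y by exact: rmorphM.
by rewrite !qmxS !(fD, fZ, fM) !IHn.
Qed.

(** * Spanning by matrix elements *)

Section Decomposition.
Variables (C : numClosedFieldType) (t : C) (A : algType C) (a b c d s : A).
Hypothesis t0 : t != 0.
Hypothesis t_root : forall n, t ^+ 2 ^+ n.+1 != 1.
Hypothesis hA : is_Asigma t a b c d s.
Variable m : forall n : nat, 'I_n.+1 -> 'I_n.+1 -> A.

Local Notation K := (qmx t a (- b) (c * s) (d * s)).
Local Notation V := (Mspace s m).

Hypothesis m_qmx : forall n (i j : 'I_n.+1),
  m i j = entry_scale t n i j *: (K n i j * s ^+ i).

Let rel := Asigma_rel hA.

(** The linear span is encoded by its induction principle, so no finite sums have to be handled. *)
Definition qmx_span (x : A) : Prop := forall P : A -> Prop,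
  P 0 -> (forall k x y, P x -> P y -> P (k *: x + y)) ->
  (forall n i j e, P (K n i j * s ^+ e)) -> P x.

Lemma qmx_span_lin k x y : qmx_span x -> qmx_span y -> qmx_span (k *: x + y).
Proof.
move=> Sx Sy P P0 Plin PK.
exact: Plin (Sx P P0 Plin PK) (Sy P P0 Plin PK).
Qed.

Lemma qmx_span_scale k x : qmx_span x -> qmx_span (k *: x).
Proof. by move=> Sx; rewrite -[_ *: _]addr0; apply: qmx_span_lin => // P. Qed.

Lemma qmx_span_basis n i j e : qmx_span (K n i j * s ^+ e).
Proof. by move=> P _ _; apply. Qed.

Lemma qmx_span_mulr g : (forall n i j e, qmx_span (K n i j * s ^+ e * g)) ->
  forall x, qmx_span x -> qmx_span (x * g).
Proof.
move=> SK x Sx; apply: (Sx (fun y => qmx_span (y * g))) => // [|k y z Sy Sz].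
  by rewrite mul0r => P.
by rewrite mulrDl -scalerAl; apply: qmx_span_lin.
Qed.

Lemma qmx_spanT x : qmx_span x.
Proof.
have comb n i j n' i' j' e k l :
    qmx_span ((k *: K n i j + l *: K n' i' j') * s ^+ e).
  rewrite mulrDl -!scalerAl; apply: qmx_span_lin; first exact: qmx_span_basis.
  by apply: qmx_span_scale; apply: qmx_span_basis.
have rel2 := Asigma_qSL2 rel.
have Sa : forall y, qmx_span y -> qmx_span (y * a).
  apply: qmx_span_mulr => n i j e.
  have -> : K n i j * s ^+ e * a = K n i j * a * s ^+ e.
    by rewrite -!mulrA; congr (_ * _); apply/esym/commrX/esym/(rel_sa rel).
  by rewrite qmx_mul_a.
have Sb : forall y, qmx_span y -> qmx_span (y * b).
  apply: qmx_span_mulr => n i j e.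
  have -> : K n i j * s ^+ e * b = (-1) ^+ e.+1 *: (K n i j * - b * s ^+ e).
    rewrite -!mulrA mulNr mulrN exprS mulN1r scaleNr scalerN opprK scalerAr.
    congr (_ * _); elim: e => [|e IHe]; first by rewrite !expr0 scale1r mul1r mulr1.
    by rewrite exprSr -mulrA (rel_sb rel) mulrN mulrA IHe exprS mulN1r scaleNr
      -scalerAl mulrA.
  by apply: qmx_span_scale; rewrite qmx_mul_b // -scaleNr.
have Ss : forall y, qmx_span y -> qmx_span (y * s).
  apply: qmx_span_mulr => n i j e; rewrite -mulrA -exprSr; exact: qmx_span_basis.
have Scs : forall y, qmx_span y -> qmx_span (y * (c * s)).
  apply: qmx_span_mulr => n i j e.
  have -> : K n i j * s ^+ e * (c * s) = (-1) ^+ e *: (K n i j * (c * s) * s ^+ e).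
    rewrite -!mulrA -exprS exprSr scalerAr; congr (_ * _).
    by rewrite !mulrA (c_sigmaX rel) -scalerAl scalerA -expr2 sqrr_sign scale1r.
  by apply: qmx_span_scale; rewrite qmx_mul_c // -scaleNr.
have Sds : forall y, qmx_span y -> qmx_span (y * (d * s)).
  apply: qmx_span_mulr => n i j e.
  have -> : K n i j * s ^+ e * (d * s) = K n i j * (d * s) * s ^+ e.
    rewrite -!mulrA -exprS exprSr; congr (_ * _).
    by rewrite !mulrA (d_sigmaX rel).
  by rewrite qmx_mul_d.
have ss := sigma_sqr rel.
have S1 : qmx_span 1 by have := qmx_span_basis 0 0 0 0; rewrite mulr1.
(* Generation is applied to the property of x that right multiplication by x preserves the span; [c]
   and [d] are [c * s] and [d * s] followed by [s]. *)
rewrite -[x]mul1r; move: x 1 S1; apply: (Asigma_gen hA) => //.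
- by move=> y Sy; rewrite -[c]mulr1 -ss !mulrA -[y * c * s]mulrA; apply: Ss; apply: Scs.
- by move=> y Sy; rewrite -[d]mulr1 -ss !mulrA -[y * d * s]mulrA; apply: Ss; apply: Sds.
- by move=> y Sy; rewrite mulr1.
- move=> k x y Sx Sy z Sz; rewrite mulrDr -scalerAr.
  by apply: qmx_span_lin; [apply: Sx | apply: Sy].
- by move=> x y Sx Sy z Sz; rewrite mulrA; apply: Sy; apply: Sx.
Qed.

Lemma Mspace0 n e : V n e 0.
Proof.
exists (fun _ _ => 0); rewrite big1 // => i _; rewrite big1 // => j _.
by rewrite scale0r.
Qed.

Lemma Mspace_lin n e k x y : V n e x -> V n e y -> V n e (k *: x + y).
Proof.
move=> [u ->] [v ->]; exists (fun i j => k * u i j + v i j).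
rewrite scaler_sumr -big_split; apply: eq_bigr => i _ /=.
rewrite scaler_sumr -big_split; apply: eq_bigr => j _ /=.
by rewrite scalerDl scalerA.
Qed.

Lemma Mspace_entry n (i j : 'I_n.+1) (e : bool) : V n e (m i j * s ^+ e).
Proof.
exists (fun i' j' => ((i' == i) && (j' == j))%:R).
rewrite (bigD1 i) //= (bigD1 j) //= !eqxx scale1r.
rewrite big1 ?addr0 => [|j' /negPf->]; last by rewrite scale0r.
rewrite big1 ?addr0 // => i' /negPf->; rewrite big1 // => j' _.
by rewrite scale0r.
Qed.

Definition Mspace_decomposable (x : A) : Prop :=
  exists N (y : nat * bool -> A), (forall ne, V ne.1 ne.2 (y ne)) /\
    x = \sum_(n < N) (y (n : nat, false) + y (n : nat, true)).

Lemma Mspace_decomposableT x : Mspace_decomposable x.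
Proof.
have P0 : Mspace_decomposable 0.
  by exists 0%N, (fun=> 0); rewrite big_ord0; split=> // ne; apply: Mspace0.
apply: (qmx_spanT x P0) => [k {}x y [N1 [y1 [V1 ->]]] [N2 [y2 [V2 ->]]]|n i j e].
  (* Both families are padded with zeros up to a common bound, so that they can be added
     termwise. *)
  pose z N (y : nat * bool -> A) ne := if (ne.1 < N)%N then y ne else 0.
  have Vz N y' : (forall ne, V ne.1 ne.2 (y' ne)) -> forall ne, V ne.1 ne.2 (z N y' ne).
    by move=> Vy ne; rewrite /z; case: ifP => // _; apply: Mspace0.
  have sumz N N' y' : (N <= N')%N -> \sum_(n < N) (y' (n : nat, false) + y' (n : nat, true))
      = \sum_(n < N') (z N y' (n : nat, false) + z N y' (n : nat, true)).
    move=> leN; rewrite (big_ord_widen _ (fun n => y' (n, false) + y' (n, true)) leN).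
    rewrite big_mkcond; apply: eq_bigr => l _; rewrite /z /=.
    by case: ifP => //; rewrite addr0.
  exists (maxn N1 N2), (fun ne => k *: z N1 y1 ne + z N2 y2 ne); split=> [ne|].
    by apply: Mspace_lin; apply: Vz.
  rewrite (sumz _ _ y1 (leq_maxl N1 N2)) (sumz _ _ y2 (leq_maxr N1 N2)).
  rewrite scaler_sumr -big_split; apply: eq_bigr => l _ /=.
  by rewrite scalerDr addrACA.
have PK (i' j' : 'I_n.+1) : Mspace_decomposable (K n i' j' * s ^+ e).
  rewrite (qmx_mul_sigma t0 t_root hA m_qmx) (sigmaX_odd hA).
  set y := _ *: _; exists n.+1, (fun ne => if ne == (n, odd (i' + e)) then y else 0).
  split=> [ne|].
    case: eqP => [->|_]; last exact: Mspace0.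
    by rewrite -[y]addr0; apply: Mspace_lin; [apply: Mspace_entry | apply: Mspace0].
  rewrite big_ord_recr big1 ?add0r => [|l _] /=; last first.
    by rewrite !xpair_eqE (ltn_eqF (ltn_ord l)) addr0.
  by rewrite !xpair_eqE eqxx; case: odd; rewrite ?addr0 ?add0r.
by apply: (qmx_cases (P := fun y => Mspace_decomposable (y * s ^+ e)));
  rewrite ?mul0r.
Qed.

End Decomposition.

(** The universal property turns this into an endomorphism changing the sign of [s] but fixing
    [c * s] and [d * s], hence every [qmx]. *)
Lemma twist_relations (C : numClosedFieldType) (t : C) (A : algType C) (a b c d s : A) :
  Asigma_relations t a b c d s -> Asigma_relations t a b (- c) (- d) (- s).
Proof.
case=> ab ac bc bd cd ad sa sd sb sc ss det; split.
- exact: ab.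
- by rewrite mulrN ac mulNr scalerN.
- by rewrite mulrN bc mulNr.
- by rewrite mulrN bd mulNr scalerN.
- by rewrite mulrNN cd mulrNN.
- by rewrite !mulrN mulNr -opprD ad scalerN.
- by rewrite mulNr sa mulrN.
- by rewrite mulrNN sd mulrNN.
- by rewrite mulNr sb mulrN.
- by rewrite mulrNN sc mulrNN.
- by rewrite sqrrN.
- by rewrite !mulrN scalerN -opprD det.
Qed.

(** * Independence of the summands *)

Section Independence.
Variables (C : numClosedFieldType) (t : C) (A : algType C) (a b c d s : A).
Hypothesis t0 : t != 0.
Hypothesis t_root : forall n, t ^+ 2 ^+ n.+1 != 1.
Hypothesis t_real : t^* = t.
Hypothesis hA : is_Asigma t a b c d s.
Variable star : A -> A.
Hypothesis hstar : is_star t a b c d s star.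
Variable m : forall n : nat, 'I_n.+1 -> 'I_n.+1 -> A.

Local Notation K := (qmx t a (- b) (c * s) (d * s)).
Local Notation V := (Mspace s m).

Hypothesis m_qmx : forall n (i j : 'I_n.+1),
  m i j = entry_scale t n i j *: (K n i j * s ^+ i).

Variable h : {scalar A}.
Hypothesis hh : is_haar s m h.

Lemma entry_scale0 : entry_scale t 0 0 0 = 1.
Proof.
rewrite /entry_scale divff ?row_scale_neq0 // (gauss0 _ 0%N) divr1 mul1r.
by rewrite /tri_sign !bin_small // !expr0 !mulr1.
Qed.

Lemma haar_qmx n i j e :
  h (K n i j * s ^+ e) = 1 * [&& n == 0%N, i == 0 & j == 0]%:R.
Proof.
rewrite mul1r; case: n => [|n].
  have hs : h (s ^+ e) = 1.
    have := qmx_mul_sigma t0 t_root hA m_qmx (ord0 : 'I_1) ord0 e.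
    rewrite entry_scale0 invr1 scale1r mul1r => ->.
    by rewrite (sigmaX_odd hA) (proj1 hh).
  by rewrite /=; case: ifP => _; rewrite ?mul1r // mul0r linear0.
apply: (qmx_cases (P := fun y => h (y * s ^+ e) = _)) => [|i' j'].
  by rewrite mul0r linear0.
rewrite (qmx_mul_sigma t0 t_root hA m_qmx) (sigmaX_odd hA) linearZ /=.
by rewrite (proj2 hh) ?mulr0.
Qed.

Lemma twisted_haar : exists h' : {scalar A}, forall n i j e,
  h' (K n i j * s ^+ e) = (1 + (-1) ^+ e) * [&& n == 0%N, i == 0 & j == 0]%:R.
Proof.
have [f [fa fb fc fd fs]] := Asigma_univ hA (twist_relations (Asigma_rel hA)).
have fN x : f (- x) = - f x by exact: rmorphN.
have fM x y : f (x * y) = f x * f y by exact: rmorphM.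
have fK n i j : f (K n i j) = K n i j.
  by rewrite qmx_morph fN !fM fa fb fc fd fs !mulrNN.
exists (h \+ (h \o f)) => n i j e /=.
rewrite fM rmorphXn /= fs fK -[- s]scaleN1r exprZn -scalerAr linearZ /= haar_qmx.
by rewrite mul1r mulrDl mul1r.
Qed.

(** Pairing with one basis element under the twisted functional isolates one coefficient: the weight
    is 1 + (-1)^(e+e0), so it is 2 for e = e0 and 0 otherwise. *)
Lemma Mspace_independent (r : seq (nat * bool)) (y : nat * bool -> A) :
  uniq r -> (forall ne, V ne.1 ne.2 (y ne)) -> \sum_(ne <- r) y ne = 0 ->
  forall ne, ne \in r -> y ne = 0.
Proof.
move=> r_uniq Vy sum0 [n0 e0] r_ne0.
have [h' h'K] := twisted_haar.
have pairing := haar_pairing t0 t_root t_real hA hstar m_qmx h'K.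
have [u0 /= y0E] := Vy (n0, e0).
suffices u0_0 i j : u0 i j = 0.
  by rewrite y0E big1 // => i _; rewrite big1 // => j _; rewrite u0_0 scale0r.
pose x := star (m i j * s ^+ e0).
have pair_sum n (e : bool) (u : 'I_n.+1 -> 'I_n.+1 -> C) :
    h' ((\sum_(k < n.+1) \sum_(l < n.+1) u k l *: (m k l * s ^+ e)) * x)
    = \sum_(k < n.+1) \sum_(l < n.+1) u k l * h' (m k l * s ^+ e * x).
  rewrite mulr_suml linear_sum; apply: eq_bigr => k _ /=.
  rewrite mulr_suml linear_sum; apply: eq_bigr => l _ /=.
  by rewrite -scalerAl linearZ.
have other ne : ne != (n0, e0) -> h' (y ne * x) = 0.
  case: ne => n e ne_ne0; have [u /= ->] := Vy (n, e).
  rewrite pair_sum big1 // => k _; rewrite big1 // => l _.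
  rewrite pairing; case: (boolP (_ && _ && _)); last by rewrite !mulr0.
  case/andP=> /andP[/eqP n_n0 /eqP ->] _.
  have e_ne0 : e != e0 by move: ne_ne0; rewrite xpair_eqE n_n0 eqxx.
  rewrite (_ : _ + (-1) ^+ _ = 0) ?(mulr0, mul0r) //.
  rewrite addnn -signr_odd oddD odd_double oddD !oddb.
  by move: e_ne0; case: (e) (e0) => [] [] //= _; rewrite expr1 subrr.
have := congr1 (fun z => h' (z * x)) sum0.
rewrite mul0r linear0 mulr_suml linear_sum (bigD1_seq (n0, e0)) //= big1_seq; last first.
  by move=> ne /andP[ne_ne0 _]; apply: other.
rewrite addr0 y0E pair_sum (bigD1 i) //= (bigD1 j) //= !big1 ?addr0.
(* Only the diagonal term is left, and its factor is 2 times t^(2(j-n0)) / [n0+1], which is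
   nonzero. *)
- rewrite pairing !eqxx mulr1 => /eqP; rewrite mulf_eq0 => /orP[/eqP //|].
  rewrite -qint_qnum // => /eqP eq0; exfalso; move/eqP: eq0; apply/negP.
  have -> : (-1) ^+ (i + i + (e0 + e0)) = 1 :> C.
    by rewrite !addnn -doubleD -mul2n exprM sqrrN !expr1n.
  rewrite -mulr2n.
  rewrite !mulf_neq0 ?signr_eq0 ?pnatr_eq0 ?invr_neq0 ?qnum_neq0 ?expfz_neq0 //.
- move=> k k_i; rewrite big1 // => l _.
  rewrite pairing (_ : (k == i :> nat) = false) ?andbF ?mulr0 //; exact: negbTE.
- move=> l l_j; rewrite pairing !eqxx.
  by rewrite (_ : (l == j :> nat) = false) ?mulr0 //; apply: negbTE.
Qed.

End Independence.

(** * The parameter t is real and t^2 is not a root of unity *)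

Section SquareRoot.
Variables (C : numClosedFieldType) (q sqrtq t : C).
Hypothesis q_lt0 : q < 0.
Hypothesis q_root : forall n : nat, (0 < n)%N -> q ^+ n != 1.
Hypothesis sqrtq_sqr : sqrtq ^+ 2 = q.
Hypothesis tE : t = 'i * sqrtq.

Lemma t_sqr : t ^+ 2 = - q.
Proof. by rewrite tE exprMn sqrCi sqrtq_sqr mulN1r. Qed.

Lemma t_neq0 : t != 0.
Proof.
by rewrite -sqrf_eq0 t_sqr oppr_eq0 lt_eqF.
Qed.

(** As t^2 = -q, squaring an equation t^(2(n+1)) = 1 gives q^(2n+2) = 1. *)
Lemma t_not_root n : t ^+ 2 ^+ n.+1 != 1.
Proof.
apply: contra_neq (q_root (ltn0Sn n.*2.+1)) => t_root.
rewrite (_ : n.*2.+2 = (2 * n.+1)%N); last by rewrite mul2n.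
by rewrite exprM -sqrrN -t_sqr exprAC t_root expr1n.
Qed.

Lemma t_conj : t^* = t.
Proof.
apply/CrealP; rewrite realEsqr t_sqr oppr_ge0; exact: ltW.
Qed.

End SquareRoot.

Section EntryFormula.
Variables (C : numClosedFieldType) (t : C) (A : algType C) (a b c d s : A).
Hypothesis t0 : t != 0.
Hypothesis t_root : forall n, t ^+ 2 ^+ n.+1 != 1.
Hypothesis hA : is_Asigma t a b c d s.
Variables (T : algType C) (tens : A -> A -> T).
Hypothesis hT : is_graded_tensor (Asigma_parity a b c d s) tens.
Variable Delta : {lrmorphism A -> T}.
Hypothesis hDelta : is_coproduct tens a b c d s Delta.
Variable m : forall n : nat, 'I_n.+1 -> 'I_n.+1 -> A.
Hypothesis hm : is_matrix_elements t a c tens Delta m.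

(** The defining equation of [m] and [coproduct_row] expand the same coproduct along the row
    vectors, so [row_unique] identifies their coefficients. *)
Lemma matrix_element_qmx n (i j : 'I_n.+1) :
  m i j = entry_scale t n i j *: (qmx t a (- b) (c * s) (d * s) n i j * s ^+ i).
Proof.
have le (k : 'I_n.+1) : (k <= n)%N by rewrite -ltnS.
have xiE (k : 'I_n.+1) : xi t a c k = row_scale t n k *: (a ^+ (n - k) * c ^+ k).
  by rewrite /xi /row_scale qbinom_gauss.
have fZ k x : Delta (k *: x) = k *: Delta x by exact: linearZ.
have := hm i; rewrite xiE fZ (coproduct_row t0 t_root (Asigma_rel hA) hT hDelta) //.
rewrite scaler_sumr.
under eq_bigr do rewrite -(tensZl hT).
under [RHS]eq_bigr do rewrite xiE (tensZr hT) -(tensZl hT).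
move/(row_unique t0 hA hT)/(_ j) => mE.
apply: (scalerI (row_scale_neq0 t0 t_root (le j))); rewrite -mE /corep !scalerA.
congr (_ *: _); rewrite /entry_scale.
have := row_scale_neq0 t0 t_root (le j); have := gauss_neq0 t0 t_root (le i).
move: (row_scale t n i) (row_scale t n j) => u v g0 v0.
by field; rewrite g0 v0.
Qed.

End EntryFormula.

(** * The decomposition *)

(** Orthogonality of the summands thereby reduces to pairs of matrix elements, by linearity in one
    argument at a time. *)
Lemma Msum_ind (C : numClosedFieldType) (A : algType C) (s : A)
    (m : forall n : nat, 'I_n.+1 -> 'I_n.+1 -> A) n (P : A -> Prop) :
  P 0 -> (forall k x y, P x -> P y -> P (k *: x + y)) ->
  (forall (i j : 'I_n.+1) (e : bool), P (m n i j * s ^+ e)) ->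
  forall x, Msum s m n x -> P x.
Proof.
move=> P0 Plin Pm.
have PD x y : P x -> P y -> P (x + y) by move=> Px Py; rewrite -[x]scale1r; apply: Plin.
have PV e x : Mspace s m n e x -> P x.
  case=> u ->; apply: (big_ind P) => // i _; apply: (big_ind P) => // j _.
  by rewrite -[_ *: _]addr0; apply: Plin.
by move=> _ [x0 [x1 [/PV Px0 /PV Px1 ->]]]; apply: PD.
Qed.

Lemma sum_pairs_seq (A : nmodType) N (y : nat * bool -> A) :
  exists r : seq (nat * bool),
    \sum_(n < N) (y (n : nat, false) + y (n : nat, true)) = \sum_(ne <- r) y ne.
Proof.
exists [seq (n, e) | n <- iota 0 N, e <- [:: false; true]].
rewrite big_allpairs_dep -[N in RHS]subn0 -/(index_iota 0 N) big_mkord.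
by apply: eq_bigr => n _; rewrite !big_cons big_nil /= addr0.
Qed.

Theorem theorem7p3 (R : realType) (q sqrtq t : R[i])
    (hq : q < 0)
    (hq_root : forall n : nat, (0 < n)%N -> q ^+ n != 1)
    (hsqrt : sqrtq ^+ 2 = q)
    (ht : t = 'i * sqrtq)
    (A : algType R[i]) (a b c d s : A)
    (hA : is_Asigma t a b c d s)
    (T : algType R[i]) (tens : A -> A -> T)
    (hT : is_graded_tensor (Asigma_parity a b c d s) tens)
    (Delta : {lrmorphism A -> T})
    (hDelta : is_coproduct tens a b c d s Delta)
    (star : A -> A) (hstar : is_star t a b c d s star)
    (m : forall n : nat, 'I_n.+1 -> 'I_n.+1 -> A)
    (hm : is_matrix_elements t a c tens Delta m)
    (h : {scalar A}) (hh : is_haar s m h) :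
  [/\ direct_sum (fun ne : nat * bool => Mspace s m ne.1 ne.2),
      orthogonal_family (formR star h) (Msum s m),
      orthogonal_family (formL star h) (Msum s m),
      (forall (n n' : nat) (i j : 'I_n.+1) (i' j' : 'I_n'.+1) (e e' : bool),
        formR star h (m n i j * s ^+ e) (m n' i' j' * s ^+ e') =
          (-1) ^+ ((e + e') * (i + j))
          * (qint t n.+1)^-1 * t ^ (2 * (j : nat)%:Z - n%:Z)
          * ((n == n') && (i == i' :> nat) && (j == j' :> nat))%:R)
    & (forall (n n' : nat) (i j : 'I_n.+1) (i' j' : 'I_n'.+1) (e e' : bool),
        formL star h (m n i j * s ^+ e) (m n' i' j' * s ^+ e') =
          (qint t n.+1)^-1 * t ^ (n%:Z - 2 * (i : nat)%:Z)
          * ((n == n') && (i == i' :> nat) && (j == j' :> nat))%:R)].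
Proof.
have t0 := t_neq0 hq hsqrt ht.
have t_root := t_not_root hq_root hsqrt ht.
have t_real := t_conj hq hsqrt ht.
have star_lin := star_antilinear hstar.
have m_qmx := matrix_element_qmx t0 t_root hA hT hDelta hm.
have hK := haar_qmx t0 t_root hA m_qmx hh.
have formRE := haar_pairing t0 t_root t_real hA hstar m_qmx hK.
have formLE := haar_pairing_left t0 t_root t_real hA hstar m_qmx hK.
have hP k x y : h (k *: x + y) = k * h x + h y by exact: linearP.
split.
- split=> [x|]; last exact: (Mspace_independent t0 t_root t_real hA hstar m_qmx hh).
  have [N [y [Vy ->]]] := Mspace_decomposableT t0 t_root hA m_qmx x.
  have [r ->] := sum_pairs_seq N y.
  by exists r, y.
- move=> n n' x y n_n' Vx Vy; rewrite /formR.
  move: x Vx y Vy; apply: Msum_ind.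
  + by move=> y _; rewrite mul0r linear0.
  + move=> k x x' IHx IHx' y Vy.
    by rewrite mulrDl -scalerAl hP IHx ?IHx' // mulr0 addr0.
  move=> i j e; apply: Msum_ind.
  + by rewrite (star0 star_lin) mulr0 linear0.
  + move=> k y y' IHy IHy'; rewrite star_lin mulrDr -scalerAr hP IHy IHy'.
    by rewrite mulr0 addr0.
  by move=> i' j' e'; rewrite formRE (negPf n_n') mulr0.
- move=> n n' x y n_n' Vx Vy; rewrite /formL.
  move: x Vx y Vy; apply: Msum_ind.
  + by move=> y _; rewrite (star0 star_lin) mul0r linear0.
  + move=> k x x' IHx IHx' y Vy.
    by rewrite star_lin mulrDl -scalerAl hP IHx ?IHx' // mulr0 addr0.
  move=> i j e; apply: Msum_ind.
  + by rewrite mulr0 linear0.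
  + move=> k y y' IHy IHy'; rewrite mulrDr -scalerAr hP IHy IHy'.
    by rewrite mulr0 addr0.
  by move=> i' j' e'; rewrite formLE (negPf n_n') mulr0.
- move=> n n' i j i' j' e e'; rewrite /formR formRE.
  by rewrite mulr1 mulrA.
- move=> n n' i j i' j' e e'; rewrite /formL formLE.
  by rewrite mul1r.
Qed.
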